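(* Let $H_{3,6}$ denote the Heawood graph. For any cubic graph $G$ of girth at least $5$ and every $\lambda>0$, \[ \frac{1}{|V(G)|}\log P_G(\lambda) \le \frac{1}{14}\log P_{H_{3,6}}(\lambda), \] and in particular \[ \frac{1}{|V(G)|}\log|\mathcal I(G)| \le \frac{1}{14}\log|\mathcal I(H_{3,6})|, \] with equality (in either inequality) if and only if $G$ is a disjoint union of copies of $H_{3,6}$.
   Context: All graphs are finite, simple and non-empty. A graph is cubic if it is $3$-regular. Girth at least $5$ means that the graph contains no cycle of length $3$ or $4$. $\mathcal I(G)$ is the set of all independent sets of $G$ (including the empty set), and $P_G(\lambda)=\sum_{I\in\mathcal I(G)}\lambda^{|I|}$ is the independence polynomial of $G$. The Heawood graph $H_{3,6}$ is the point-line incidence graph of the Fano plane (a $3$-regular, vertex-transitive graph on $14$ vertices of girth $6$). ''$G$ is a (disjoint) union of copies of $H$'' means that every connected component of $G$ is isomorphic to $H$. *)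

(* Defs.v *)
From mathcomp Require Import all_boot all_order all_algebra.
From mathcomp Require Import all_reals exp.

Set Implicit Arguments.
Unset Strict Implicit.
Unset Printing Implicit Defensive.

Import Order.TTheory GRing.Theory Num.Theory.

Record sgraph := SGraph {
  vertex :> finType;
  adj : rel vertex;
  adj_sym : symmetric adj;
  adj_irr : irreflexive adj }.

Definition cubic (G : sgraph) : Prop :=
  forall x : G, #|[set y | adj x y]| = 3.

(* A graph cycle is a duplicate-free closed walk on at least three vertices;
   an acyclic graph has girth at least [g] for every [g]. *)
Definition girth_at_least (g : nat) (G : sgraph) : Prop :=
  forall c : seq G, 2 < size c -> ucycle (@adj G) c -> g <= size c.

Definition indep_sets (G : sgraph) : {set {set G}} :=
  [set I : {set G} | [forall x in I, forall y in I, ~~ adj x y]].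

Definition indep_poly (R : realType) (G : sgraph) (lambda : R) : R :=
  (\sum_(I in indep_sets G) lambda ^+ #|I|)%R.

Definition isomorphic (G H : sgraph) : Prop :=
  exists2 f : G -> H, bijective f & forall x y, adj (f x) (f y) = adj x y.

Section Induced.
Variables (G : sgraph) (P : pred G).

Definition induced_adj : rel {x : G | P x} := fun u v => adj (val u) (val v).

Lemma induced_sym : symmetric induced_adj.
Proof. by move=> u v; apply: adj_sym. Qed.

Lemma induced_irr : irreflexive induced_adj.
Proof. by move=> u; apply: adj_irr. Qed.

Definition induced : sgraph := SGraph induced_sym induced_irr.

End Induced.

Definition component (G : sgraph) (x : G) : sgraph :=
  induced (connect (@adj G) x).

Definition union_of_copies (H G : sgraph) : Prop :=
  forall x : G, isomorphic (component x) H.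

(* The Fano plane in its cyclic presentation: points and lines are both indexed
   by Z/7, and line [l] is the translate {l, l+1, l+3} of the perfect difference
   set {0, 1, 3}. *)
Definition fano_incident (p l : 'I_7) : bool :=
  (p : nat) \in [:: l %% 7; (l + 1) %% 7; (l + 3) %% 7].

Lemma fano_points_on_line (l : 'I_7) : #|[set p | fano_incident p l]| = 3.
Proof.
rewrite -sum1_card big_mkcond /= !big_ord_recl big_ord0 !inE.
by case: l; do 7?[case=> //].
Qed.

Lemma fano_line_through (p q : 'I_7) :
  p != q -> #|[set l | fano_incident p l && fano_incident q l]| = 1.
Proof.
rewrite -sum1_card big_mkcond /= !big_ord_recl big_ord0 !inE.
by case: p q; do 7?[case=> //] => ? [] /=; do 7?[case=> //].
Qed.

Lemma fano_lines_meet (l m : 'I_7) :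
  l != m -> #|[set p | fano_incident p l && fano_incident p m]| = 1.
Proof.
rewrite -sum1_card big_mkcond /= !big_ord_recl big_ord0 !inE.
by case: l m; do 7?[case=> //] => ? [] /=; do 7?[case=> //].
Qed.

(* Points are tagged [inl], lines [inr]. *)
Definition heawood_adj : rel ('I_7 + 'I_7)%type := fun u v =>
  match u, v with
  | inl p, inr l | inr l, inl p => fano_incident p l
  | _, _ => false
  end.

Lemma heawood_sym : symmetric heawood_adj.
Proof. by case=> ? []. Qed.

Lemma heawood_irr : irreflexive heawood_adj.
Proof. by case. Qed.

Definition heawood : sgraph := SGraph heawood_sym heawood_irr.

(* Main.v *)
Require Import Defs.
From Stdlib Require Import ZArith.
From mathcomp Require Import all_boot all_order all_algebra.
From mathcomp Require Import ssrZ ring.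
From mathcomp Require Import all_reals exp.
From mathcomp Require Import normedtype derive realfun.

Set Implicit Arguments.
Unset Strict Implicit.
Unset Printing Implicit Defensive.

Import Order.TTheory GRing.Theory Num.Theory.
Import numFieldNormedType.Exports.

(** Occupancy method. Both [ln P_G / |G|] and [ln P_H / 14] vanish at 0, so by
    the mean value theorem it suffices to compare their derivatives, that is,
    the expected densities of a random independent set [I] of law
    proportional to [lambda ^ #|I|]. Let [N(v)] be the number of neighbours of
    [v] in [I]. In a cubic graph, averaging over [v] any function [c] of
    [N(v)], or the mean of [c] over the neighbours of [v], gives the same
    result, so [3F + 3c(N(v)) - \sum_(u ~ v) c(N(u)) - 3D [v \in I]] sums over
    [v] to [3(F |G| - D |I|)]. For suitable polynomials [D, F, c] in [lambda]
    its conditional expectation given [I] outside the ball of radius 2 around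
    [v] is never negative: girth 5 leaves finitely many possible balls, and for
    each of them a computation shows that the relevant polynomial in [lambda]
    has nonnegative coefficients.

    The conditional expectation always vanishes exactly when [v] and any vertex
    at the end of a walk of length 3 from [v] are such that the latter has a
    common neighbour with every neighbour of [v]. In a cubic graph of girth at
    least 5 this forces the component of [v] to be the Heawood graph, which
    itself has the property; hence equality holds for the Heawood graph, and
    strict inequality whenever some component is different. *)

Delimit Scope Z_scope with BinZ.

(** ** The dual certificate and its verification *)

(* Polynomials are lists of binary integer coefficients, constant term first. *)
Fixpoint zpadd (p q : seq Z) : seq Z :=
  match p, q with
  | [::], _ => q
  | _, [::] => p
  | a :: p', b :: q' => Z.add a b :: zpadd p' q'
  end.

Definition zpscale (c : Z) (p : seq Z) : seq Z := map (Z.mul c) p.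

Fixpoint masks (n : nat) : seq bitseq :=
  if n is n'.+1 then
    let m := masks n' in map (cons true) m ++ map (cons false) m
  else [:: [::]].

(* A bit list [b] selects indices; [F] says which ones may be selected and [E]
   which pairs [i < j] may not be selected together. *)
Definition allowed (F : pred nat) (E : rel nat) (b : bitseq) : bool :=
  let s := mask b (iota 0 (size b)) in
  all F s && pairwise (fun i j => ~~ E i j) s.

(** [ncons] shifts the coefficients, so each allowed selection is weighted by the variable to the
    power of its size, like an independent set. *)
Definition zpsum_masks n F E (phi : bitseq -> seq Z) : seq Z :=
  foldr (fun b acc =>
    if allowed F E b then zpadd (ncons (count id b) 0%BinZ (phi b)) acc else acc)
    [::] (masks n).

(* [F/D] and [c_t/D], normalised by [c_3 = 0], solve the linear system stating
   that the slack is zero in the four kinds of balls met in the Heawood graph: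
   no edge among the vertices at distance 2, and (2,2,2), (1,1,1), (1,0,0) or
   (0,0,0) of them with no occupied neighbour at distance 3. *)
Definition Dpoly : seq Z := [:: 2; 31; 183; 532; 826; 707; 343; 102; 20; 2]%BinZ.
Definition Fpoly : seq Z := [:: 0; 2; 23; 97; 193; 199; 114; 40; 9; 1]%BinZ.
Definition cpoly (t : nat) : seq Z :=
  match t with
  | 0 => [:: -3; -27; -94; -139; -20; 139; 124; 45; 9; 1]%BinZ
  | 1 => [:: -3; -27; -97; -172; -124; 38; 118; 70; 16; 1]%BinZ
  | 2 => [:: -3; -30; -121; -254; -292; -178; -49; -2; 1]%BinZ
  | _ => [::]
  end.

Definition bit (b : bitseq) (i : nat) : nat := nth false b i.

(* Index 0 is the centre [v], indices 1, 2, 3 are its neighbours [u_k], and [s_k]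
   is the number of occupied neighbours of [u_k] other than [v]. *)
Definition star_free (s0 s1 s2 : nat) (i : nat) : bool :=
  nth true [:: true; s0 == 0; s1 == 0; s2 == 0] i.

Definition star_edge (i j : nat) : bool := (i == 0) != (j == 0).

Definition star_gain (s0 s1 s2 : nat) (b : bitseq) : seq Z :=
  zpadd (zpadd (zpscale 3%BinZ Fpoly)
    (zpscale 3%BinZ (cpoly (bit b 1 + bit b 2 + bit b 3))))
  (zpadd
    (zpscale (-1)%BinZ
      (zpadd (cpoly (bit b 0 + s0))
        (zpadd (cpoly (bit b 0 + s1)) (cpoly (bit b 0 + s2)))))
    (if nth false b 0 then zpscale (-3)%BinZ Dpoly else [::])).

(** Up to normalisation, the conditional expectation of the gain at the centre given the
    configuration outside the star. *)
Definition star_slack (s0 s1 s2 : nat) : seq Z :=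
  zpsum_masks 4 (star_free s0 s1 s2) star_edge (star_gain s0 s1 s2).

(* [ball_slack] looks the values up in this table: recomputing them for each ball
   would be slow. *)
Definition star_table : seq (seq (seq (seq Z))) :=
  Eval vm_compute in
  [seq [seq [seq star_slack s0 s1 s2 | s2 <- iota 0 3] | s1 <- iota 0 3]
    | s0 <- iota 0 3].

Definition star_lookup (s0 s1 s2 : nat) : seq Z :=
  nth [::] (nth [::] (nth [::] star_table s0) s1) s2.

(* Indices 2k and 2k+1 are the neighbours of [u_k] other than [v]. *)
Definition ball_slack F E : seq Z :=
  zpsum_masks 6 F E (fun b =>
    star_lookup (bit b 0 + bit b 1) (bit b 2 + bit b 3) (bit b 4 + bit b 5)).

(* [a], [b], [c] record the edges between the vertices attached to [u_0] and [u_1],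
   [u_0] and [u_2], [u_1] and [u_2]. *)
Definition ball_edge (a b c : bitseq) (i j : nat) : bool :=
  match i, j with
  | 0, 2 => nth false a 0 | 0, 3 => nth false a 1
  | 1, 2 => nth false a 2 | 1, 3 => nth false a 3
  | 0, 4 => nth false b 0 | 0, 5 => nth false b 1
  | 1, 4 => nth false b 2 | 1, 5 => nth false b 3
  | 2, 4 => nth false c 0 | 2, 5 => nth false c 1
  | 3, 4 => nth false c 2 | 3, 5 => nth false c 3
  | _, _ => false
  end.

(** Two edges at one vertex between the pairs attached to two of the [u_k] would close a 4-cycle
    through one of these [u_k]. The four implications keep only the edges between free vertices. *)
Definition matching (f g f' g' : bool) (a : bitseq) : bool :=
  if a is [:: p; q; r; s] then
    [&& ~~ (p && q), ~~ (r && s), ~~ (p && r), ~~ (q && s),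
     p ==> f && f', q ==> f && g', r ==> g && f' & s ==> g && g']
  else false.

(** Vertices attached to the same [u_k] are not adjacent, so a triangle takes one vertex from each
    pair. *)
Definition triangle_free (a b c : bitseq) : bool :=
  let e := ball_edge a b c in
  ~~ has (fun i => has (fun j => e i j &&
       has (fun k => e i k && e j k) [:: 4; 5]) [:: 2; 3]) [:: 0; 1].

Definition two_free (f : bitseq) : bool :=
  [|| nth false f 0 && nth false f 1, nth false f 2 && nth false f 3
    | nth false f 4 && nth false f 5].

Definition no_edge (a b c : bitseq) := ~~ [|| has id a, has id b | has id c].

Definition not_two_singles (f : bitseq) :=
  let m := (nth false f 0 (+) nth false f 1) +
    (nth false f 2 (+) nth false f 3) + (nth false f 4 (+) nth false f 5) in
  m != 2.

(** One fully free pair makes the slack positive, except in the edgeless ball with six free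
    vertices, where it vanishes. *)
Definition ball_strict f a b c :=
  two_free f && ~~ (all id f && no_edge a b c).

Definition ball_tight f a b c :=
  no_edge a b c && (all id f || ~~ two_free f && not_two_singles f).

(** Signs are tested on the coefficients, which settles all positive values of the variable at
    once. *)
Definition ball_check (f a b c : bitseq) : bool :=
  let p := ball_slack (nth false f) (ball_edge a b c) in
  [&& all (Z.leb 0) p,
      (if ball_strict f a b c then has (Z.ltb 0) p else true) &
      (if ball_tight f a b c then all (Z.eqb 0) p else true)].

Definition ball_check_all : bool :=
  all (fun f =>
    let m i j := filter (matching (nth false f i) (nth false f i.+1)
                          (nth false f j) (nth false f j.+1)) (masks 4) in
    all (fun a => all (fun b => all (fun c =>
      if triangle_free a b c then ball_check f a b c else true)
      (m 2 4)) (m 0 4)) (m 0 2)) (masks 6).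

Lemma ball_check_allT : ball_check_all.
Proof. by vm_compute. Qed.

Local Open Scope ring_scope.

(** * Evaluation and sign of coefficient lists *)

Section Eval.
Variables (R : realDomainType) (x : R).

Fixpoint zpeval (p : seq Z) : R :=
  if p is c :: p' then (int_of_Z c)%:~R + x * zpeval p' else 0.

Lemma zpevalD p q : zpeval (zpadd p q) = zpeval p + zpeval q.
Proof.
elim: p q => [|a p IHp] [|b q] /=; rewrite ?add0r ?addr0 //.
by rewrite IHp -[Z.add a b]/(a + b) !rmorphD /=; ring.
Qed.

Lemma zpevalZ c p : zpeval (zpscale c p) = (int_of_Z c)%:~R * zpeval p.
Proof.
elim: p => [|a p IHp] /=; rewrite ?mulr0 //.
by rewrite IHp -[Z.mul c a]/(c * a) !rmorphM /=; ring.
Qed.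

Lemma zpeval_ncons k p : zpeval (ncons k 0%BinZ p) = x ^+ k * zpeval p.
Proof.
by elim: k => [|k IHk] /=; rewrite ?expr0 ?mul1r // IHk exprS mulrA add0r.
Qed.

Lemma zpeval_sum_masks n F E phi :
  zpeval (zpsum_masks n F E phi) =
    \sum_(b <- masks n | allowed F E b) x ^+ count id b * zpeval (phi b).
Proof.
rewrite /zpsum_masks; elim: (masks n) => [|b m IHm] /=; first by rewrite big_nil.
by rewrite big_cons; case: ifP => _ //; rewrite zpevalD zpeval_ncons IHm.
Qed.

Lemma int_of_Z_ge0 (c : Z) : Z.leb 0%BinZ c -> 0 <= (int_of_Z c)%:~R :> R.
Proof. by case: c => // p _; rewrite ler0z. Qed.

Lemma int_of_Z_gt0 (c : Z) : Z.ltb 0%BinZ c -> 0 < (int_of_Z c)%:~R :> R.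
Proof.
by case: c => // p _; rewrite ltr0z /= ltz_nat; apply/ssrnat.ltP/Pos2Nat.is_pos.
Qed.

Hypothesis x_gt0 : 0 < x.

Lemma zpeval_ge0 p : all (Z.leb 0%BinZ) p -> 0 <= zpeval p.
Proof.
elim: p => //= c p IHp /andP[c_ge0 /IHp p_ge0].
by rewrite addr_ge0 ?int_of_Z_ge0 // mulr_ge0 // ltW.
Qed.

Lemma zpeval_gt0 p : all (Z.leb 0%BinZ) p -> has (Z.ltb 0%BinZ) p -> 0 < zpeval p.
Proof.
elim: p => //= c p IHp /andP[c_ge0 p_ge0] /orP[c_gt0|/(IHp p_ge0) p_gt0].
  by rewrite ltr_pwDl ?int_of_Z_gt0 // mulr_ge0 ?zpeval_ge0 // ltW.
by rewrite ltr_wpDl ?int_of_Z_ge0 // mulr_gt0.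
Qed.

Lemma zpeval_eq0 p : all (Z.eqb 0%BinZ) p -> zpeval p = 0.
Proof.
by elim: p => //= -[|c|c] p IHp //= /IHp ->; rewrite mulr0 addr0.
Qed.

End Eval.

(** * Splitting a sum over subsets along a list of elements *)

Section Peel.
Variables (T : finType) (V : nmodType).
Implicit Types (X I J : {set T}) (h : {set T} -> V) (xs : seq T).

Lemma disjoint_setU1 (A : {pred T}) x X :
  [disjoint x |: X & A] = (x \notin A) && [disjoint X & A].
Proof.
rewrite -disjointU1; apply: eq_disjoint => y.
by rewrite !inE.
Qed.

(** A set avoiding [X] either avoids [x] too or is [x |: I] for a unique such [I]; the two are
    paired. *)
Lemma sum_disjointU1 X x h : x \notin X ->
  \sum_(I : {set T} | [disjoint I & X]) h I =
  \sum_(I : {set T} | [disjoint I & x |: X]) (h I + h (x |: I)).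
Proof.
move=> xX; rewrite big_split /= (bigID (fun I : {set T} => x \in I)) /= addrC.
have disjU1 I : [disjoint I & x |: X] = [disjoint I & X] && (x \notin I).
  by rewrite ![[disjoint I & _]]disjoint_sym disjoint_setU1 andbC.
congr (_ + _); first by apply: eq_bigl => I; rewrite disjU1.
rewrite (reindex_onto (fun I => x |: I) (fun I => I :\ x)) /=; last first.
  by move=> I /andP[_ xI]; rewrite setD1K.
apply: eq_bigl => I; rewrite disjU1 setU11 andbT disjoint_setU1 xX /=.
congr (_ && _); case: (boolP (x \in I)) => [xI|xI]; last by rewrite setU1K // eqxx.
by apply/negbTE/eqP => eqI; move: xI; rewrite -eqI setD11.
Qed.

Lemma sum_disjoint_masks xs X h : uniq xs -> [disjoint X & xs] ->
  \sum_(I : {set T} | [disjoint I & X]) h I =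
  \sum_(J : {set T} | [disjoint J & X :|: [set:: xs]])
     \sum_(b <- masks (size xs)) h (J :|: [set:: mask b xs]).
Proof.
elim: xs X h => [|x xs IHxs] X h /=.
  move=> _ _; rewrite set_nil setU0; apply: eq_bigr => I _.
  by rewrite big_seq1 set_nil setU0.
case/andP=> x_xs uniq_xs; rewrite disjoint_sym disjoint_cons => /andP[xX disj].
rewrite (sum_disjointU1 _ xX) IHxs //; last first.
  by rewrite disjoint_setU1 x_xs disjoint_sym.
have -> : (x |: X) :|: [set:: xs] = X :|: [set:: x :: xs].
  by rewrite set_cons setUCA setUA.
apply: eq_bigr => J _; rewrite big_split /= big_cat !big_map /= addrC.
congr (_ + _); apply: eq_bigr => b _ //=.
by rewrite set_cons setUCA.
Qed.

End Peel.

(** * The weight of an independent set and its Markov property *)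

Definition nbhd (G : sgraph) (v : G) : {set G} := [set y | adj v y].

Section Weight.
Variables (R : realType) (G : sgraph) (x : R).
Implicit Types (v : G) (I J : {set G}) (xs : seq G).

Lemma indepP I :
  reflect (forall a b, a \in I -> b \in I -> ~~ adj a b) (I \in indep_sets G).
Proof.
rewrite inE; apply: (iffP forall_inP) => [indI a b aI bI|indI a aI].
  by have /forall_inP := indI _ aI; apply.
by apply/forall_inP => b; apply: indI.
Qed.

Definition hweight I : R := if I \in indep_sets G then x ^+ #|I| else 0.

Lemma size_masks n b : b \in masks n -> size b = n.
Proof.
elim: n b => [|n IHn] b /=; first by rewrite inE => /eqP ->.
by rewrite mem_cat => /orP[] /mapP[c /IHn <- ->].
Qed.

Lemma allowed_maskE (F : pred G) (E : rel G) v xs b : size b = size xs ->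
  allowed (fun i => F (nth v xs i)) (fun i j => E (nth v xs i) (nth v xs j)) b
  = all F (mask b xs) && pairwise (fun y z => ~~ E y z) (mask b xs).
Proof.
move=> sz_b.
have -> : mask b xs = map (nth v xs) (mask b (iota 0 (size b))).
  by rewrite map_mask sz_b -/(mkseq _ _) mkseq_nth.
by rewrite all_map pairwise_map.
Qed.

Lemma indep_setU_mask v xs J b : size b = size xs ->
  (J :|: [set:: mask b xs] \in indep_sets G) =
  (J \in indep_sets G) &&
  allowed (fun i => [disjoint J & nbhd (nth v xs i)])
    (fun i j => adj (nth v xs i) (nth v xs j)) b.
Proof.
move=> sz_b; rewrite (@allowed_maskE (fun y => [disjoint J & nbhd y]) (@adj G)) //.
rewrite pairwise_all2rel; last first.
- by move=> y z; rewrite adj_sym.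
- by move=> y; rewrite adj_irr.
apply/indepP/and3P => [indI|[/indepP indJ /allP frJ /allrelP indK]].
  split.
  - by apply/indepP => a c aJ cJ; apply: indI; rewrite inE ?aJ ?cJ.
  - apply/allP => y y_m; rewrite -setI_eq0; apply/eqP/setP => z; rewrite !inE.
    by apply/negP => /andP[zJ]; apply/negP/indI; rewrite !inE ?y_m ?zJ ?orbT.
  - by apply/allrelP => y z ym zm; apply: indI; rewrite !inE ?ym ?zm orbT.
have JK a c : a \in J -> c \in mask b xs -> ~~ adj c a.
  by move=> aJ /frJ /disjointFr /(_ aJ); rewrite inE => ->.
move=> a c; rewrite !inE => /orP[aJ|aK] /orP[cJ|cK].
- exact: indJ.
- by rewrite adj_sym JK.
- by rewrite JK.
- exact: indK.
Qed.

Lemma hweight_mask v xs J b :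
    uniq xs -> [disjoint J & xs] -> size b = size xs ->
  hweight (J :|: [set:: mask b xs]) =
  hweight J *
    (if allowed (fun i => [disjoint J & nbhd (nth v xs i)])
                (fun i j => adj (nth v xs i) (nth v xs j)) b
     then x ^+ count id b else 0).
Proof.
move=> uniq_xs disj sz_b; rewrite /hweight (indep_setU_mask v) //.
case: (J \in _); rewrite ?mul0r //=; case: ifP; rewrite ?mulr0 // => _.
have JK : J :&: [set:: mask b xs] = set0.
  apply/eqP; rewrite setI_eq0; apply: disjointWr disj.
  by apply/subsetP => y; rewrite inE => /mem_mask.
rewrite cardsU JK cards0 subn0 exprD cardsE.
by rewrite (card_uniqP _) ?mask_uniq // size_mask.
Qed.

(** Spatial Markov property, without normalisation: given the part [J] outside [xs], the trace on
    [xs] is weighted as an independent set of vertices having no neighbour in [J]. *)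
Lemma sum_hweight v xs (X : {set G}) (phi : {set G} -> R) :
    uniq xs -> [disjoint X & xs] ->
  \sum_(I : {set G} | [disjoint I & X]) hweight I * phi I =
  \sum_(J : {set G} | [disjoint J & X :|: [set:: xs]])
    hweight J *
    \sum_(b <- masks (size xs) |
          allowed (fun i => [disjoint J & nbhd (nth v xs i)])
                  (fun i j => adj (nth v xs i) (nth v xs j)) b)
       x ^+ count id b * phi (J :|: [set:: mask b xs]).
Proof.
move=> uniq_xs disj.
rewrite (sum_disjoint_masks _ uniq_xs disj); apply: eq_bigr => J disjJ.
rewrite [in RHS]big_mkcond mulr_sumr [LHS]big_seq [RHS]big_seq.
apply: eq_bigr => b /size_masks sz_b; rewrite (hweight_mask v) //; last first.
  apply: disjointWr disjJ; apply/subsetP => y y_xs; rewrite !inE.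
  by apply/orP; right.
by case: ifP; rewrite ?mulr0 ?mul0r // mulrA.
Qed.

End Weight.

(** Edges need to agree only between indices permitted by [F]; this is why the edges recorded for a
    ball may omit those at blocked vertices. *)
Lemma allowed_ext n (F F' : pred nat) (E E' : rel nat) b : size b = n ->
    (forall i, (i < n)%N -> F i = F' i) ->
    (forall i j, (i < j < n)%N -> F i -> F j -> E i j = E' i j) ->
  allowed F E b = allowed F' E' b.
Proof.
move=> sz_b eqF eqE; rewrite /allowed sz_b.
set s := mask b _.
have s_lt : all (fun i => i < n)%N s.
  by apply/allP => i /mem_mask; rewrite mem_iota.
(* The selected indices increase, so [pairwise] queries only pairs [i < j]. *)
have s_sorted : pairwise ltn s.
  by rewrite pairwise_mask // -(sorted_pairwise ltn_trans) iota_ltn_sorted.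
elim: s s_lt s_sorted => [|i s IHs] //= /andP[i_lt s_lt] /andP[i_s s_sorted].
rewrite -eqF // -!andbA; case Fi: (F i) => //=.
have {IHs} := IHs s_lt s_sorted.
have -> : all F' s = all F s.
  by apply/esym/eq_in_all => j /(allP s_lt); apply: eqF.
case Fs: (all F s) => //= ->; congr (_ && _).
apply: eq_in_all => j js; congr negb; apply: eqE => //.
  by apply/andP; split; [exact: (allP i_s) | exact: (allP s_lt)].
exact: (allP Fs).
Qed.

Lemma mem_setU_mask (T : finType) (xs : seq T) (J : {set T}) b y i :
    uniq xs -> size b = size xs -> [disjoint J & xs] -> (i < size xs)%N ->
  (nth y xs i \in J :|: [set:: mask b xs]) = nth false b i.
Proof.
move=> uniq_xs sz_b disj i_lt; have xs_i : nth y xs i \in xs by apply: mem_nth.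
by rewrite !inE in_mask // xs_i index_uniq // (disjointFl disj xs_i).
Qed.

Lemma mem_setU_maskN (T : finType) (xs : seq T) (J : {set T}) b y :
  y \notin xs -> (y \in J :|: [set:: mask b xs]) = (y \in J).
Proof.
by move=> y_xs; rewrite !inE (contraNF (@mem_mask _ y b xs)) ?orbF.
Qed.

(** * The gain of a vertex and its total over the graph *)

Section Gain.
Variables (R : realType) (G : sgraph) (x : R).
Implicit Types (v : G) (I J : {set G}).

Definition degree_in v I : nat := #|nbhd v :&: I|.

Definition gain v I : R :=
  3 * zpeval x Fpoly + 3 * zpeval x (cpoly (degree_in v I))
  - \sum_(u in nbhd v) zpeval x (cpoly (degree_in u I))
  - 3 * zpeval x Dpoly * (v \in I)%:R.

Lemma sum_gain I : cubic G ->
  \sum_v gain v I =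
    3 * (#|G|%:R * zpeval x Fpoly) - 3 * (#|I|%:R * zpeval x Dpoly).
Proof.
move=> cubG.
(* Double counting: each [u] is a neighbour of exactly three vertices. *)
have sum_nbrs (h : G -> R) : \sum_v \sum_(u in nbhd v) h u = 3 * \sum_v h v.
  rewrite (exchange_big_dep predT) //= mulr_sumr; apply: eq_bigr => u _.
  rewrite sumr_const -[LHS]mulr_natl; congr (_%:R * _).
  rewrite -(cubG u) cardsE; apply: eq_card => v.
  by transitivity (u \in nbhd v); rewrite // inE adj_sym.
have sum_mem : \sum_(v : G) (v \in I)%:R = #|I|%:R :> R.
  rewrite -sum1_card natr_sum [RHS]big_mkcond /=.
  by apply: eq_bigr => v _; case: (v \in I).
rewrite /gain !big_split /= !sumrN sum_nbrs -!mulr_sumr sum_mem sumr_const.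
by rewrite -mulr_natl; ring.
Qed.

Lemma degree_in_set3 v p q r I : nbhd v = [set p; q; r] -> uniq [:: p; q; r] ->
  degree_in v I = ((p \in I) + (q \in I) + (r \in I))%N.
Proof.
move=> nbhd_v uniq_pqr; rewrite /degree_in -sum1_card.
rewrite (eq_bigl (fun y => (y \in [:: p; q; r]) && (y \in I))); last first.
  by move=> y; rewrite nbhd_v !inE orbA.
rewrite big_mkcondr -big_uniq //= !big_cons big_nil addn0 addnA.
by case: (p \in I) (q \in I) (r \in I) => [] [] [].
Qed.

End Gain.

Lemma sum_nbhd3 (V : nmodType) (G : sgraph) (v p q r : G) (h : G -> V) :
    nbhd v = [set p; q; r] -> uniq [:: p; q; r] ->
  \sum_(u in nbhd v) h u = h p + h q + h r.
Proof.
move=> nbhd_v uniq_pqr.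
rewrite (eq_bigl [in [:: p; q; r]]); last by move=> y; rewrite nbhd_v !inE orbA.
by rewrite -big_uniq //= !big_cons big_nil addr0 addrA.
Qed.

(** ** Summation over a ball of radius 2 *)

Definition is_ball (G : sgraph) (v u0 u1 u2 w0 w1 w2 w3 w4 w5 : G) : Prop :=
  [/\ nbhd v = [set u0; u1; u2], nbhd u0 = [set v; w0; w1],
      nbhd u1 = [set v; w2; w3], nbhd u2 = [set v; w4; w5] &
      uniq [:: v; u0; u1; u2; w0; w1; w2; w3; w4; w5]].

Lemma disjoint_set3r (T : finType) (J : {set T}) p q r :
  [disjoint J & [set p; q; r]] = [&& p \notin J, q \notin J & r \notin J].
Proof.
rewrite disjoint_sym -setUA disjoint_setU1 disjoint_setU1.
by rewrite -[[set r]]setU0 disjoint_setU1 -setI_eq0 set0I eqxx andbT.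
Qed.

Definition in2 (T : finType) (M : {set T}) (a b : T) : nat :=
  ((a \in M) + (b \in M))%N.

Section Ball.
Variables (R : realType) (G : sgraph) (x : R).
Variables (v u0 u1 u2 w0 w1 w2 w3 w4 w5 : G).
Hypothesis ballP : is_ball v u0 u1 u2 w0 w1 w2 w3 w4 w5.
Implicit Types I J M : {set G}.

Local Notation star := [:: v; u0; u1; u2].
Local Notation rim := [:: w0; w1; w2; w3; w4; w5].

(** All neighbours of the centre lie in the star, so it is always free; [u_k] is free unless [M]
    meets its pair of rim vertices. *)
Lemma star_frees M : [disjoint M & star] ->
  forall i, (i < 4)%N -> [disjoint M & nbhd (nth v star i)] =
    star_free (in2 M w0 w1) (in2 M w2 w3) (in2 M w4 w5) i.
Proof.
case: ballP => Nv N0 N1 N2 _ disj.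
have notin y : y \in star -> y \notin M by move=> /(disjointFl disj) ->.
have v_M : v \notin M by rewrite notin ?inE ?eqxx.
have [u0_M u1_M u2_M] : [/\ u0 \notin M, u1 \notin M & u2 \notin M].
  by split; rewrite notin // !inE eqxx ?orbT.
case=> [|[|[|[|]]]] //= _;
  rewrite ?Nv ?N0 ?N1 ?N2 disjoint_set3r ?v_M ?u0_M ?u1_M ?u2_M //=.
- by rewrite /star_free /in2 /=; case: (w0 \in M) (w1 \in M) => [] [].
- by rewrite /star_free /in2 /=; case: (w2 \in M) (w3 \in M) => [] [].
- by rewrite /star_free /in2 /=; case: (w4 \in M) (w5 \in M) => [] [].
Qed.

Lemma star_edges i j : (i < j < 4)%N ->
  adj (nth v star i) (nth v star j) = star_edge i j.
Proof.
case: ballP => Nv N0 N1 N2 uniqB.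
have adjE a b : adj a b = (b \in nbhd a) by rewrite inE.
case/andP; case: j => [|[|[|[|j]]]] //; case: i => [|[|[|i]]] //= _ _;
  rewrite /star_edge adjE ?Nv ?N0 ?N1 ?N2 !inE ?eqxx ?orbT //.
all: apply/negbTE/negP. all: move=> /orP[/orP[]|] /eqP eq_uw; move: uniqB.
all: by rewrite eq_uw /= !inE !eqxx ?orbT /= ?andbF.
Qed.


Lemma gain_star M b : [disjoint M & star] -> size b = 4%N ->
  gain x v (M :|: [set:: mask b star]) =
  zpeval x (star_gain (in2 M w0 w1) (in2 M w2 w3) (in2 M w4 w5) b).
Proof.
case: ballP => Nv N0 N1 N2 uniqB disj sz_b.
have uniq_star : uniq star.
  by move: uniqB; rewrite -[X in uniq X]/(star ++ rim) cat_uniq => /andP[].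
have rimN y : y \in rim -> y \notin star.
  move: uniqB; rewrite -[X in uniq X]/(star ++ rim) cat_uniq => /and3P[_ /hasPn + _].
  exact.
set I := _ :|: _.
have memS i : (i < 4)%N -> (nth v star i \in I) = nth false b i.
  by move=> i_lt; apply: mem_setU_mask.
have memR y : y \in rim -> (y \in I) = (y \in M).
  by move=> /rimN; apply: mem_setU_maskN.
pose t := true; pose f := false.
(* [U] turns a bit list into the distinctness of the vertices it selects among the ten of the
   ball. *)
have U := mask_uniq uniqB.
have Uv : uniq [:: u0; u1; u2] := U [:: f; t; t; t].
have U0 : uniq [:: v; w0; w1] := U [:: t; f; f; f; t; t].
have U1 : uniq [:: v; w2; w3] := U [:: t; f; f; f; f; f; t; t].
have U2 : uniq [:: v; w4; w5] := U [:: t; f; f; f; f; f; f; f; t; t].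
rewrite /gain (sum_nbhd3 _ Nv Uv) (degree_in_set3 _ Nv Uv) (degree_in_set3 _ N0 U0).
rewrite (degree_in_set3 _ N1 U1) (degree_in_set3 _ N2 U2).
have rim_i i : (i < 6)%N -> nth v rim i \in rim := @mem_nth _ v rim i.
rewrite (memS 0) // (memS 1) // (memS 2) // (memS 3) //.
rewrite (memR w0) ?(rim_i 0) // (memR w1) ?(rim_i 1) // (memR w2) ?(rim_i 2) //.
rewrite (memR w3) ?(rim_i 3) // (memR w4) ?(rim_i 4) // (memR w5) ?(rim_i 5) //.
rewrite /star_gain !zpevalD !zpevalZ -!addnA -!/(in2 _ _ _).
rewrite -[bit b 0]/(nat_of_bool (nth false b 0)).
have -> : zpeval x (if nth false b 0 then zpscale (-3)%BinZ Dpoly else [::])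
          = -3 * zpeval x Dpoly * (nth false b 0)%:R.
  by case: (nth false b 0); rewrite ?mulr0 ?mulr1 // zpevalZ.
have -> : (int_of_Z 3)%:~R = 3 :> R by [].
have -> : (int_of_Z (-1)%BinZ)%:~R = -1 :> R by [].
move: (zpeval x Fpoly) (zpeval x Dpoly) => F D.
by rewrite !zpevalD /bit; ring.
Qed.

Lemma sum_gain_star :
  \sum_(I : {set G}) hweight x I * gain x v I =
  \sum_(M : {set G} | [disjoint M & [set:: star]])
    hweight x M * zpeval x (star_slack (in2 M w0 w1) (in2 M w2 w3) (in2 M w4 w5)).
Proof.
have uniq_star : uniq star.
  have [_ _ _ _ uniqB] := ballP.
  exact: mask_uniq uniqB [:: true; true; true; true].
rewrite (eq_bigl (fun I => [disjoint I & set0])); last first.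
  by move=> I; rewrite disjoint_sym -setI_eq0 set0I eqxx.
rewrite (@sum_hweight R G x v star set0 _ uniq_star); last first.
  by apply: eq_disjoint0 => y; rewrite !inE.
rewrite set0U; apply: eq_bigr => M disjM.
have {}disjM : [disjoint M & star].
  by apply: disjointWr disjM; apply/subsetP => y; rewrite inE.
congr (_ * _); rewrite zpeval_sum_masks [LHS]big_seq_cond [RHS]big_seq_cond.
apply: eq_big => [b|b /andP[bm _]]; last by rewrite gain_star ?(size_masks bm).
rewrite /=; case bm: (b \in masks 4) => //; have sz_b := size_masks bm; rewrite !andTb.
apply: allowed_ext sz_b (star_frees disjM) _ => i j ij _ _.
exact: star_edges.
Qed.

End Ball.

(** * Matching actual balls with the configurations computed *)

Definition triangle_less (G : sgraph) : Prop :=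
  forall a b c : G, adj a b -> adj b c -> adj a c -> False.

Definition square_less (G : sgraph) : Prop :=
  forall a b c d : G, adj a b -> adj b c -> adj c d -> adj d a ->
    a != c -> b != d -> False.

Lemma star_lookupE s0 s1 s2 : (s0 < 3)%N -> (s1 < 3)%N -> (s2 < 3)%N ->
  star_lookup s0 s1 s2 = star_slack s0 s1 s2.
Proof.
by case: s0 => [|[|[|]]] //; case: s1 => [|[|[|]]] //; case: s2 => [|[|[|]]] // _ _ _;
  vm_compute.
Qed.

Lemma mem_masks b : b \in masks (size b).
Proof.
elim: b => [|b0 b IHb] //=; rewrite mem_cat.
by apply/orP; case: b0; [left|right]; apply/mapP; exists b.
Qed.

(** [masks] contains every bit list, so the exhaustive computation covers all values of the eighteen
    bits. *)
Lemma ball_checkT f0 f1 f2 f3 f4 f5 a0 a1 a2 a3 b0 b1 b2 b3 c0 c1 c2 c3 :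
  let f := [:: f0; f1; f2; f3; f4; f5] in
  let a := [:: a0; a1; a2; a3] in
  let b := [:: b0; b1; b2; b3] in
  let c := [:: c0; c1; c2; c3] in
  matching f0 f1 f2 f3 a -> matching f0 f1 f4 f5 b -> matching f2 f3 f4 f5 c ->
  triangle_free a b c -> ball_check f a b c.
Proof.
move=> f a b c Ma Mb Mc tri.
have memM p q r s (e : bitseq) : size e = 4%N -> matching p q r s e ->
    e \in filter (matching p q r s) (masks 4).
  by move=> sz_e Me; rewrite mem_filter Me -sz_e mem_masks.
have check_f := allP ball_check_allT f (mem_masks f).
have check_a := allP check_f a (memM f0 f1 f2 f3 a (erefl 4%N) Ma).
have check_b := allP check_a b (memM f0 f1 f4 f5 b (erefl 4%N) Mb).
have := allP check_b c (memM f2 f3 f4 f5 c (erefl 4%N) Mc).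
by rewrite tri.
Qed.

Section Ball.
Variables (R : realType) (G : sgraph) (x : R).
Hypotheses (noC3 : triangle_less G) (noC4 : square_less G).
Variables (v u0 u1 u2 w0 w1 w2 w3 w4 w5 : G).
Hypothesis ballP : is_ball v u0 u1 u2 w0 w1 w2 w3 w4 w5.
Implicit Types I J M : {set G}.

Local Notation star := [:: v; u0; u1; u2].
Local Notation rim := [:: w0; w1; w2; w3; w4; w5].

Definition free_of J y : bool := [disjoint J & nbhd y].
Definition free_edge J y z : bool := [&& adj y z, free_of J y & free_of J z].
Definition free_edges J (p : seq G) : bitseq :=
  if p is [:: y0; y1; z0; z1] then
    [:: free_edge J y0 z0; free_edge J y0 z1; free_edge J y1 z0; free_edge J y1 z1]
  else [::].

Definition ball_flags J : bitseq := map (free_of J) rim.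
Definition edges01 J := free_edges J [:: w0; w1; w2; w3].
Definition edges02 J := free_edges J [:: w0; w1; w4; w5].
Definition edges12 J := free_edges J [:: w2; w3; w4; w5].

Lemma ball_adj :
  [/\ [/\ adj v u0, adj v u1 & adj v u2],
      [/\ adj u0 w0 & adj u0 w1], [/\ adj u1 w2 & adj u1 w3] &
      [/\ adj u2 w4 & adj u2 w5]].
Proof.
have adjE a b : adj a b = (b \in nbhd a) by rewrite inE.
by case: ballP => Nv N0 N1 N2 _; rewrite !adjE Nv N0 N1 N2 !inE !eqxx !orbT.
Qed.

Lemma matching_edges J u u' y0 y1 z0 z1 :
    adj u y0 -> adj u y1 -> adj u' z0 -> adj u' z1 ->
    uniq [:: u; u'; y0; y1; z0; z1] ->
  matching (free_of J y0) (free_of J y1) (free_of J z0) (free_of J z1)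
    (free_edges J [:: y0; y1; z0; z1]).
Proof.
move=> uy0 uy1 uz0 uz1 U.
set s := [:: u; u'; y0; y1; z0; z1] in U.
have neq i j : (i < j < 6)%N -> nth u s i != nth u s j.
  case/andP=> ij j6; rewrite nth_uniq ?ltn_eqF //; exact: ltn_trans ij j6.
rewrite /matching /= /free_edge.
have C1 : ~~ (adj y0 z0 && adj y0 z1).
  apply/negP => /andP[p q]; apply: (@noC4 y0 z0 u' z1); rewrite // 1?adj_sym //.
  - by rewrite eq_sym (neq 1 2).
  - exact: (neq 4 5).
have C2 : ~~ (adj y1 z0 && adj y1 z1).
  apply/negP => /andP[p q]; apply: (@noC4 y1 z0 u' z1); rewrite // 1?adj_sym //.
  - by rewrite eq_sym (neq 1 3).
  - exact: (neq 4 5).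
have C3 : ~~ (adj y0 z0 && adj y1 z0).
  apply/negP => /andP[p q]; apply: (@noC4 y0 z0 y1 u); rewrite // 1?adj_sym //.
  - exact: (neq 2 3).
  - by rewrite eq_sym (neq 0 4).
have C4 : ~~ (adj y0 z1 && adj y1 z1).
  apply/negP => /andP[p q]; apply: (@noC4 y0 z1 y1 u); rewrite // 1?adj_sym //.
  - exact: (neq 2 3).
  - by rewrite eq_sym (neq 0 5).
move: C1 C2 C3 C4; do 4!case: (adj _ _); do 4!case: (free_of _ _) => //.
Qed.

Lemma ball_check_config J :
  ball_check (ball_flags J) (edges01 J) (edges02 J) (edges12 J).
Proof.
have [[_ _ _] [u0w0 u0w1] [u1w2 u1w3] [u2w4 u2w5]] := ball_adj.
have [_ _ _ _ uniqB] := ballP.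
pose t := true; pose f := false.
have U := mask_uniq uniqB.
apply: ball_checkT.
- exact: (matching_edges J u0w0 u0w1 u1w2 u1w3 (U [:: f; t; t; f; t; t; t; t])).
- exact: (matching_edges J u0w0 u0w1 u2w4 u2w5 (U [:: f; t; f; t; t; t; f; f; t; t])).
- exact: (matching_edges J u1w2 u1w3 u2w4 u2w5 (U [:: f; f; t; t; f; f; t; t; t; t])).
apply/negP => /hasP[i i01 /hasP[j j23 /andP[eij /hasP[k k45 /andP[eik ejk]]]]].
move: i01 j23 k45 eij eik ejk; rewrite !inE.
by do 3!(case/orP=> /eqP->); rewrite /= => /and3P[yz _ _] /and3P[yt _ _] /and3P[zt _ _];
  exact: noC3 yz zt yt.
Qed.

Lemma ball_edges J i j : (i < j < 6)%N ->
    free_of J (nth v rim i) -> free_of J (nth v rim j) ->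
  adj (nth v rim i) (nth v rim j) =
  ball_edge (edges01 J) (edges02 J) (edges12 J) i j.
Proof.
have [[_ _ _] [u0w0 u0w1] [u1w2 u1w3] [u2w4 u2w5]] := ball_adj.
have sib (u y z : G) : adj u y -> adj u z -> adj y z = false.
  by move=> uy uz; apply/negbTE/negP => yz; exact: noC3 uy yz uz.
case/andP; case: j => [|[|[|[|[|[|j]]]]]] //; case: i => [|[|[|[|[|i]]]]] //= _ _ F1 F2;
  rewrite /free_edge ?F1 ?F2 ?andbT //.
- exact: sib u0w0 u0w1.
- exact: sib u1w2 u1w3.
- exact: sib u2w4 u2w5.
Qed.

Lemma in2_mask J b : [disjoint J & rim] -> size b = 6%N ->
  let M := J :|: [set:: mask b rim] in
  [/\ in2 M w0 w1 = (bit b 0 + bit b 1)%N, in2 M w2 w3 = (bit b 2 + bit b 3)%N &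
      in2 M w4 w5 = (bit b 4 + bit b 5)%N].
Proof.
move=> disj sz_b M; have [_ _ _ _ uniqB] := ballP.
have uniq_rim : uniq rim := mask_uniq uniqB
  [:: false; false; false; false; true; true; true; true; true; true].
have memW i : (i < 6)%N -> (nth v rim i \in M) = nth false b i.
  by move=> i_lt; apply: mem_setU_mask.
by rewrite /in2 (memW 0) // (memW 1) // (memW 2) // (memW 3) // (memW 4) // (memW 5).
Qed.

(** [sum_hweight] is applied a second time, to the rim. The inner sum depends on [J] only through
    the free rim vertices and the edges between them. *)
Lemma sum_gain_ball :
  \sum_(I : {set G}) hweight x I * gain x v I =
  \sum_(J : {set G} | [disjoint J & [set:: star] :|: [set:: rim]])
    hweight x J * zpeval x
      (ball_slack (nth false (ball_flags J))
                  (ball_edge (edges01 J) (edges02 J) (edges12 J))).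
Proof.
have [_ _ _ _ uniqB] := ballP.
have uniq_rim : uniq rim := mask_uniq uniqB
  [:: false; false; false; false; true; true; true; true; true; true].
rewrite (sum_gain_star x ballP).
rewrite (@sum_hweight R G x v rim [set:: star] _ uniq_rim); last first.
  move: uniqB; rewrite -[X in uniq X]/(star ++ rim) cat_uniq => /and3P[_ disj _].
  rewrite disjoint_sym disjoint_has; apply: contra disj => /hasP[y y_rim y_star].
  by apply/hasP; exists y => //; move: y_star; rewrite /= in_set.
apply: eq_bigr => J disjJ.
have {}disjJ : [disjoint J & rim].
  apply: disjointWr disjJ; apply/subsetP => y y_rim.
  by rewrite in_setU !in_set orbC [_ \in rim]y_rim.
congr (_ * _); rewrite zpeval_sum_masks [LHS]big_seq_cond [RHS]big_seq_cond.
apply: eq_big => [b|b /andP[bm _]].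
  rewrite /=; case bm: (b \in masks 6) => //; have sz_b := size_masks bm.
  rewrite !andTb; apply: (allowed_ext sz_b) => [i i6|]; last exact: ball_edges.
  by rewrite (nth_map v).
have [-> -> ->] := in2_mask disjJ (size_masks bm).
by rewrite star_lookupE // /bit; do 2!case: (nth false b _).
Qed.

End Ball.

(* [x] ranges over the ends of the walks of length 3 from [v]. *)
Definition heawood_like (G : sgraph) : bool :=
  [forall v : G, forall u : G, forall w : G, forall x : G, forall u' : G,
    [&& adj v u, adj u w, adj w x & adj v u'] ==>
    [exists y : G, adj u' y && adj y x]].

Lemma heawood_likeP (G : sgraph) :
  reflect (forall v u w x u' : G, adj v u -> adj u w -> adj w x -> adj v u' ->
             exists2 y, adj u' y & adj y x)
          (heawood_like G).
Proof.
apply: (iffP idP) => [HG v u w x u' vu uw wx vu'|HG].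
  move: HG => /forallP/(_ v)/forallP/(_ u)/forallP/(_ w)/forallP/(_ x)/forallP/(_ u').
  by rewrite vu uw wx vu' => /existsP[y /andP[]]; exists y.
apply/forallP => v; apply/forallP => u; apply/forallP => w; apply/forallP => x.
apply/forallP => u'; apply/implyP => /and4P[vu uw wx vu'].
have [y u'y yx] := HG v u w x u' vu uw wx vu'.
by apply/existsP; exists y; rewrite u'y yx.
Qed.

(** * Sign of the expected gain in a cubic graph *)

Section Cubic.
Variables (R : realType) (G : sgraph) (x : R).
Hypotheses (cubG : cubic G) (noC3 : triangle_less G) (noC4 : square_less G).
Hypothesis x_gt0 : 0 < x.
Implicit Types (v u w y z : G) (J : {set G}).

Lemma adj_neq v u : adj v u -> v != u.
Proof. by apply: contraTneq => ->; rewrite adj_irr. Qed.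

Lemma cubic_nbhd v u : adj v u ->
  exists y z, nbhd v = [set u; y; z] /\ uniq [:: u; y; z].
Proof.
move=> vu; have : #|nbhd v :\ u| == 2%N.
  by have := cubG v; rewrite -/(nbhd v) (cardsD1 u) inE vu add1n => -[->].
case/cards2P=> y [z [yz Nvu]].
have uN : u \notin [set y; z] by rewrite -Nvu setD11.
exists y, z; split; first by rewrite -setUA -Nvu setD1K ?inE.
by move: uN; rewrite /= !inE negb_or yz andbT => ->.
Qed.

Lemma cubic_nbhd2 v u u' : adj v u -> adj v u' -> u != u' ->
  exists z, nbhd v = [set u; u'; z] /\ uniq [:: u; u'; z].
Proof.
move=> vu vu' uu'; have [y [z [Nv U]]] := cubic_nbhd vu.
have : u' \in nbhd v by rewrite inE.
rewrite Nv !inE eq_sym (negbTE uu') /= => /orP[] /eqP eq_u'.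
  by exists z; rewrite eq_u'.
exists y; rewrite eq_u' setUAC; split=> //.
by move: U; rewrite /= !inE !negb_or !andbT [y == z]eq_sym => /andP[/andP[-> ->] ->].
Qed.

Lemma in_nbhd3 v a b c : nbhd v = [set a; b; c] -> [/\ adj v a, adj v b & adj v c].
Proof.
move=> Nv; have E y : adj v y = (y \in nbhd v) by rewrite inE.
by rewrite !E Nv !inE !eqxx !orbT.
Qed.

(** A coincidence among the ten vertices would close a triangle or a square. Two neighbours and an
    outer vertex are prescribed so that the ball can follow a given walk. *)
Lemma ball_exists v u u' w : adj v u -> adj v u' -> u != u' ->
    adj u w -> w != v ->
  exists u2 w1 w2 w3 w4 w5, is_ball v u u' u2 w w1 w2 w3 w4 w5.
Proof.
move=> vu vu' uu' uw wv.
have [u2 [Nv]] := cubic_nbhd2 vu vu' uu'.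
rewrite /= !inE !negb_or !andbT => /andP[/andP[_ uu2] u'u2].
have [_ _ vu2] := in_nbhd3 Nv.
have uv : adj u v by rewrite adj_sym.
have u'v : adj u' v by rewrite adj_sym.
have u2v : adj u2 v by rewrite adj_sym.
have vw : v != w by rewrite eq_sym.
have [w1 [Nu Uu]] := cubic_nbhd2 uv uw vw.
have [w2 [w3 [Nu' Uu']]] := cubic_nbhd u'v.
have [w4 [w5 [Nu2 Uu2]]] := cubic_nbhd u2v.
exists u2, w1, w2, w3, w4, w5; split=> //.
have [_ _ uw1] := in_nbhd3 Nu.
have [_ u'w2 u'w3] := in_nbhd3 Nu'.
have [_ u2w4 u2w5] := in_nbhd3 Nu2.
(* [B] rules out triangles through [v], and [C] squares through [v]. *)
have B a b c : adj v a -> adj v b -> adj b c -> a != c.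
  move=> va vb bc; apply/eqP => eq_ac; rewrite -eq_ac in bc.
  exact: noC3 vb bc va.
have C a b c d : adj v a -> adj v b -> a != b -> adj a c -> adj b d -> v != c ->
    c != d.
  move=> va vb ab ac bd vc; apply/eqP => eq_cd; rewrite -eq_cd in bd.
  by apply: (noC4 va ac _ _ vc ab); rewrite adj_sym.
move: Uu Uu' Uu2; rewrite /= !inE !negb_or !andbT.
move=> /andP[/andP[_ vw1] ww1] /andP[/andP[vw2 vw3] w23] /andP[/andP[vw4 vw5] w45].
do ?[apply/andP; split] => //.
all: by [apply: adj_neq | apply: (B _ u) | apply: (B _ u') | apply: (B _ u2)
  | apply: (C u u') | apply: (C u u2) | apply: (C u' u2)].
Qed.

Lemma hweight_ge0 J : 0 <= hweight x J.
Proof. by rewrite /hweight; case: ifP => // _; rewrite exprn_ge0 // ltW. Qed.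

Lemma some_ball v :
  exists u0 u1 u2 w0 w1 w2 w3 w4 w5, is_ball v u0 u1 u2 w0 w1 w2 w3 w4 w5.
Proof.
have /card_gt0P[u] : (0 < #|nbhd v|)%N by rewrite [#|_|](cubG v).
rewrite inE => vu.
have [u' [u2' [Nv /=]]] := cubic_nbhd vu.
rewrite !inE negb_or => /andP[/andP[uu' _] _].
have [_ vu' _] := in_nbhd3 Nv.
have uv : adj u v by rewrite adj_sym.
have [w [w' [Nu /=]]] := cubic_nbhd uv.
rewrite !inE negb_or => /andP[/andP[vw _] _].
have [_ uw _] := in_nbhd3 Nu.
have wv : w != v by rewrite eq_sym.
have [u2 [w1 [w2 [w3 [w4 [w5 ballP]]]]]] := ball_exists vu vu' uu' uw wv.
by exists u, u', u2, w, w1, w2, w3, w4, w5.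
Qed.

Lemma sum_gain_ge0 v : 0 <= \sum_(I : {set G}) hweight x I * gain x v I.
Proof.
have [u0 [u1 [u2 [w0 [w1 [w2 [w3 [w4 [w5 ballP]]]]]]]]] := some_ball v.
rewrite (sum_gain_ball x noC3 ballP); apply: sumr_ge0 => J _.
rewrite mulr_ge0 ?hweight_ge0 // zpeval_ge0 //.
by have /and3P[] := ball_check_config noC3 noC4 ballP J.
Qed.

(** All terms are nonnegative, so one outer configuration with strict slack suffices. *)
Lemma sum_gain_gt0 v u0 u1 u2 w0 w1 w2 w3 w4 w5 J :
    is_ball v u0 u1 u2 w0 w1 w2 w3 w4 w5 -> J \in indep_sets G ->
    [disjoint J & [set:: [:: v; u0; u1; u2; w0; w1; w2; w3; w4; w5]]] ->
    ball_strict (ball_flags w0 w1 w2 w3 w4 w5 J) (edges01 w0 w1 w2 w3 J)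
      (edges02 w0 w1 w4 w5 J) (edges12 w2 w3 w4 w5 J) ->
  0 < \sum_(I : {set G}) hweight x I * gain x v I.
Proof.
move=> ballP indJ disjJ strictJ.
rewrite (sum_gain_ball x noC3 ballP) (bigD1 J) /=; last first.
  apply: disjointWr disjJ; apply/subsetP => y.
  by rewrite !inE -!orbA.
have pos K : all (Z.leb 0%BinZ)
    (ball_slack (nth false (ball_flags w0 w1 w2 w3 w4 w5 K))
      (ball_edge (edges01 w0 w1 w2 w3 K) (edges02 w0 w1 w4 w5 K)
        (edges12 w2 w3 w4 w5 K))).
  by have /and3P[] := ball_check_config noC3 noC4 ballP K.
rewrite ltr_pwDl //.
  rewrite mulr_gt0 //; first by rewrite /hweight indJ exprn_gt0.
  apply: zpeval_gt0 => //.
  have /and3P[_ + _] := ball_check_config noC3 noC4 ballP J.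
  by rewrite strictJ.
apply: sumr_ge0 => K _.
by rewrite mulr_ge0 ?hweight_ge0 // zpeval_ge0.
Qed.

Lemma free_ofN J y z : adj y z -> z \in J -> free_of J y = false.
Proof.
move=> yz zJ; apply/negbTE/negP => /disjointFr/(_ zJ).
by rewrite inE yz.
Qed.

Lemma free_ofP J y : reflect (exists2 z, z \in J & adj y z) (~~ free_of J y).
Proof.
apply: (iffP idP) => [|[z zJ yz]]; last by rewrite (free_ofN yz zJ).
by rewrite /free_of -setI_eq0 => /set0Pn[z /setIP[zJ]]; rewrite inE; exists z.
Qed.

Lemma free_of0 y : free_of set0 y.
Proof. by rewrite /free_of -setI_eq0 set0I. Qed.

Lemma free_of1 y z : free_of [set z] y = ~~ adj y z.
Proof.
rewrite /free_of -[[set z]]setU0 disjoint_setU1 inE.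
by rewrite -setI_eq0 set0I eqxx andbT.
Qed.

Lemma not_heawood_like_gain_gt0 : ~~ heawood_like G ->
  exists v, 0 < \sum_(I : {set G}) hweight x I * gain x v I.
Proof.
move=> /forallPn[v /forallPn[u /forallPn[w /forallPn[z /forallPn[u']]]]].
rewrite negb_imply => /andP[/and4P[vu uw wz vu'] /existsPn no_y].
exists v.
have {}no_y y : adj u' y -> ~~ adj y z by move=> u'y; have := no_y y; rewrite u'y.
have vz : ~~ adj v z by apply: no_y; rewrite adj_sym.
have wv : w != v by apply: contraNneq vz => <-.
have uu' : u != u' by apply: contraTneq wz => eq_u; apply: no_y; rewrite -eq_u.
have [u2 [w1 [w2 [w3 [w4 [w5 ballP]]]]]] := ball_exists vu vu' uu' uw wv.
have [[_ _ vu2] [_ uw1] [u'w2 u'w3] [u2w4 u2w5]] := ball_adj ballP.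
have zv : z != v.
  by apply/negP => /eqP eq_z; rewrite eq_z adj_sym in wz; apply: noC3 vu uw wz.
have zN a : adj v a -> z != a by move=> va; apply: contraNneq vz => ->.
(* If [z] is in the rim, the empty outer set leaves the rim fully free but with the edge [wz]. *)
case z_rim : (z \in [:: w; w1; w2; w3; w4; w5]).
  apply: (@sum_gain_gt0 _ _ _ _ _ _ _ _ _ _ set0 ballP).
  - by apply/indepP => a b; rewrite inE.
  - by rewrite -setI_eq0 set0I.
  rewrite /ball_strict /ball_flags /= !free_of0 /= /no_edge negbK.
  rewrite /edges01 /edges02 /= /free_edge !free_of0 !andbT.
  move: z_rim; rewrite !inE => /orP[/eqP eq_z|/orP[/eqP eq_z|]].
  - by rewrite eq_z adj_irr in wz.
  - by rewrite eq_z in wz; case: (noC3 uw wz uw1).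
  by do ?[case/orP]; move/eqP=> eq_z; rewrite eq_z in wz; rewrite wz ?orbT.
(* Otherwise [z] blocks [w], while both outer neighbours of [u'] stay free. *)
apply: (@sum_gain_gt0 _ _ _ _ _ _ _ _ _ _ [set z] ballP).
- by apply/indepP => a b; rewrite !inE => /eqP-> /eqP->; rewrite adj_irr.
- rewrite -[[set z]]setU0 disjoint_setU1 -setI_eq0 set0I eqxx andbT.
  move: z_rim; rewrite !inE (negbTE zv) (negbTE (zN _ vu)) (negbTE (zN _ vu')).
  by rewrite (negbTE (zN _ vu2)) => ->.
by rewrite /ball_strict /ball_flags /= !free_of1 wz (no_y w2) // (no_y w3) //= orbT.
Qed.

(** Every outer configuration is tight: a vertex of [J] that blocks one rim vertex ends a walk of
    length 3 from [v], hence blocks a vertex of each pair. *)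
Lemma heawood_like_sum_gain v : heawood_like G ->
  \sum_(I : {set G}) hweight x I * gain x v I = 0.
Proof.
move=> /heawood_likeP HG.
have [u0 [u1 [u2 [w0 [w1 [w2 [w3 [w4 [w5 ballP]]]]]]]]] := some_ball v.
have [[vu0 vu1 vu2] [u0w0 u0w1] [u1w2 u1w3] [u2w4 u2w5]] := ball_adj ballP.
have [Nv N0 N1 N2 uniqB] := ballP.
rewrite (sum_gain_ball x noC3 ballP); apply: big1 => J disjJ.
(* An edge [ww'] would make [w'] the end of a walk of length 3; then [u'], [w'] and their common
   neighbour would form a triangle. *)
have no_edge_rim u w u' w' : adj v u -> adj u w -> adj v u' -> adj u' w' ->
    adj w w' = false.
  move=> vu uw vu' uw'; apply/negbTE/negP => ww'.
  by have [y u'y yw'] := HG v u w w' u' vu uw ww' vu'; apply: noC3 u'y yw' uw'.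
have outside z : z \in J -> ~~ adj v z.
  move=> zJ; apply/negP => vz; have := disjointFr disjJ zJ.
  have: z \in nbhd v by rewrite inE.
  by rewrite Nv !inE => /orP[/orP[]|] ->; rewrite ?orbT.
have blocked_in u z p q : adj v u -> nbhd u = [set v; p; q] -> z \in J ->
    (exists2 u', adj v u' & exists2 w, adj u' w & adj w z) ->
    exists2 y, y \in [:: p; q] & adj y z.
  move=> vu Nu zJ [u' vu' [w u'w wz]].
  have [y uy yz] := HG v u' w z u vu' u'w wz vu.
  have : y \in nbhd u by rewrite inE.
  rewrite Nu !inE => /orP[/orP[/eqP eq_y|y_p]|y_q].
  - by rewrite eq_y (negbTE (outside z zJ)) in yz.
  - by exists y; rewrite // !inE y_p.
  - by exists y; rewrite // !inE y_q orbT.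
pose free := free_of J.
have not_two u w p q : adj v u -> nbhd u = [set v; p; q] ->
    (exists2 u', adj v u' & adj u' w) -> ~~ free w -> ~~ (free p && free q).
  move=> vu Nu [u' vu' u'w] /free_ofP[z zJ wz].
  have [|y] := @blocked_in u z p q vu Nu zJ; first by exists u' => //; exists w.
  by rewrite !inE => /orP[/eqP->|/eqP->] yz; rewrite /free (free_ofN yz zJ) ?andbF.
(* Blockers [z], [z'] of the two vertices of a pair are distinct, or a square through [u] arises. In
   a pair with one free vertex, the blocked one is adjacent to both; two such pairs would give a
   square. *)
have not_single u w w' l l' p q p' q' :
    adj v u -> adj u w -> adj u w' -> w != w' -> ~~ free w -> ~~ free w' ->
    adj v l -> nbhd l = [set v; p; q] -> adj v l' -> nbhd l' = [set v; p'; q'] ->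
    ~~ has [in [:: p'; q']] [:: p; q] ->
    (free p (+) free q) && (free p' (+) free q') = false.
  move=> vu uw uw' ww' /free_ofP[z zJ wz] /free_ofP[z' z'J w'z'] vl Nl vl' Nl' disj.
  have zz' : z != z'.
    apply/eqP => eq_z; rewrite -eq_z in w'z'.
    apply: (noC4 uw wz _ _ _ ww'); rewrite 1?adj_sym //.
    by apply: contraNneq (outside z zJ) => <-.
  have share k p1 q1 : adj v k -> nbhd k = [set v; p1; q1] -> free p1 (+) free q1 ->
      exists y, [/\ y \in [:: p1; q1], adj y z & adj y z'].
    move=> vk Nk xor1.
    have [|y yk yz] := @blocked_in k z p1 q1 vk Nk zJ.
      by exists u => //; exists w.
    have [|y' y'k y'z'] := @blocked_in k z' p1 q1 vk Nk z'J.
      by exists u => //; exists w'.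
    exists y; split=> //; suff -> : y = y' by [].
    move: xor1 (free_ofN yz zJ) (free_ofN y'z' z'J); move: yk y'k; rewrite /free !inE.
    by case/orP=> /eqP->; case/orP=> /eqP->; move=> // + F1 F2; rewrite F1 F2.
  apply/negbTE/negP => /andP[/(share _ _ _ vl Nl)[y [yl yz yz']]].
  move=> /(share _ _ _ vl' Nl')[y' [yl' y'z y'z']].
  have yy' : y != y'.
    apply/eqP => eq_y; case/negP: disj; apply/hasP; exists y => //.
    by rewrite /= eq_y.
  by apply: (noC4 yz _ y'z' _ yy' zz'); rewrite adj_sym.
have tight : ball_tight (ball_flags w0 w1 w2 w3 w4 w5 J) (edges01 w0 w1 w2 w3 J)
    (edges02 w0 w1 w4 w5 J) (edges12 w2 w3 w4 w5 J).
  have no01 w w' : adj u0 w -> adj u1 w' -> adj w w' = false.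
    by move=> uw uw'; apply: no_edge_rim vu0 uw vu1 uw'.
  have no02 w w' : adj u0 w -> adj u2 w' -> adj w w' = false.
    by move=> uw uw'; apply: no_edge_rim vu0 uw vu2 uw'.
  have no12 w w' : adj u1 w -> adj u2 w' -> adj w w' = false.
    by move=> uw uw'; apply: no_edge_rim vu1 uw vu2 uw'.
  rewrite /ball_tight /no_edge /edges01 /edges02 /edges12 /= /free_edge.
  rewrite (no01 _ _ u0w0 u1w2) (no01 _ _ u0w0 u1w3) (no01 _ _ u0w1 u1w2).
  rewrite (no01 _ _ u0w1 u1w3) (no02 _ _ u0w0 u2w4) (no02 _ _ u0w0 u2w5).
  rewrite (no02 _ _ u0w1 u2w4) (no02 _ _ u0w1 u2w5) (no12 _ _ u1w2 u2w4).
  rewrite (no12 _ _ u1w2 u2w5) (no12 _ _ u1w3 u2w4) (no12 _ _ u1w3 u2w5) /=.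
  have blocked_all u w : adj v u -> adj u w -> ~~ free w ->
      [/\ ~~ (free w0 && free w1), ~~ (free w2 && free w3)
        & ~~ (free w4 && free w5)].
    move=> vu uw w_blocked; have via : exists2 u', adj v u' & adj u' w by exists u.
    split; [exact: not_two vu0 N0 via w_blocked | exact: not_two vu1 N1 via w_blocked
      | exact: not_two vu2 N2 via w_blocked].
  have dicho : [&& free w0, free w1, free w2, free w3, free w4 & free w5]
      || [&& ~~ (free w0 && free w1), ~~ (free w2 && free w3)
           & ~~ (free w4 && free w5)].
    have via u w : adj v u -> adj u w -> free w = false ->
        [&& ~~ (free w0 && free w1), ~~ (free w2 && free w3)
          & ~~ (free w4 && free w5)].
      move=> vu uw /negbT w_blocked.
      by have [-> -> ->] := blocked_all u w vu uw w_blocked.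
    move: (via _ _ vu0 u0w0) (via _ _ vu0 u0w1) (via _ _ vu1 u1w2) (via _ _ vu1 u1w3).
    move: (via _ _ vu2 u2w4) (via _ _ vu2 u2w5).
    by do 6!case: (free _) => //=; do ?[move=> /(_ erefl) //|move=> _].
  pose t := true; pose f := false; have U := mask_uniq uniqB.
  have U01 : uniq ([:: w0; w1] ++ [:: w2; w3]) := U [:: f; f; f; f; t; t; t; t].
  have U02 : uniq ([:: w0; w1] ++ [:: w4; w5]) := U [:: f; f; f; f; t; t; f; f; t; t].
  have U12 : uniq ([:: w2; w3] ++ [:: w4; w5]) := U [:: f; f; f; f; f; f; t; t; t; t].
  have split_uniq p q p' q' : uniq ([:: p; q] ++ [:: p'; q']) ->
      p != q /\ ~~ has [in [:: p; q]] [:: p'; q'].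
    by rewrite cat_uniq /= inE andbT => /and3P[-> ? _].
  have [w01 D01] := split_uniq _ _ _ _ _ U01.
  have [_ D02] := split_uniq _ _ _ _ _ U02.
  have [w23 D12] := split_uniq _ _ _ _ _ U12.
  have [w45 _] : w4 != w5 /\ true.
    by have := U [:: f; f; f; f; f; f; f; f; t; t]; rewrite /= inE andbT.
  (* Exactly two pairs with a single free vertex would leave the third fully blocked; [not_single]
     excludes this for each choice of the third. *)
  have S0 : [&& ~~ free w0, ~~ free w1, free w4 (+) free w5
      & free w2 (+) free w3] = false.
    apply/negbTE/negP => /and3P[b0 b1].
    by rewrite (not_single _ _ _ _ _ _ _ _ _ vu0 u0w0 u0w1 w01 b0 b1 vu2 N2 vu1 N1 D12).
  have S1 : [&& ~~ free w2, ~~ free w3, free w4 (+) free w5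
      & free w0 (+) free w1] = false.
    apply/negbTE/negP => /and3P[b0 b1].
    by rewrite (not_single _ _ _ _ _ _ _ _ _ vu1 u1w2 u1w3 w23 b0 b1 vu2 N2 vu0 N0 D02).
  have S2 : [&& ~~ free w4, ~~ free w5, free w2 (+) free w3
      & free w0 (+) free w1] = false.
    apply/negbTE/negP => /and3P[b0 b1].
    by rewrite (not_single _ _ _ _ _ _ _ _ _ vu2 u2w4 u2w5 w45 b0 b1 vu1 N1 vu0 N0 D01).
  move: dicho S0 S1 S2; rewrite /two_free /not_two_singles /= -!/(free _).
  by do 6!case: (free _).
have /and3P[_ _] := ball_check_config noC3 noC4 ballP J.
by rewrite tight => /(zpeval_eq0 x) ->; rewrite mulr0.
Qed.

End Cubic.

(** ** Characterization of the Heawood graph *)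

Lemma girth5_triangle_less (G : sgraph) : girth_at_least 5 G -> triangle_less G.
Proof.
move=> girthG a b c ab bc ac; suff: (5 <= 3)%N by [].
apply: (girthG [:: a; b; c]) => //; rewrite /ucycle /= ab bc adj_sym ac /=.
by rewrite !inE negb_or !adj_neq.
Qed.

Lemma girth5_square_less (G : sgraph) : girth_at_least 5 G -> square_less G.
Proof.
move=> girthG a b c d ab bc cd da ac bd; suff: (5 <= 4)%N by [].
apply: (girthG [:: a; b; c; d]) => //; rewrite /ucycle /= ab bc cd da /=.
by rewrite !inE !negb_or ac bd [a == d]eq_sym !adj_neq.
Qed.

Lemma fano_lines_through_point (p : 'I_7) : #|[set l | fano_incident p l]| = 3%N.
Proof.
rewrite -sum1_card big_mkcond /= !big_ord_recl big_ord0 !inE.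
by case: p; do 7?[case=> //].
Qed.

Lemma heawood_cubic : cubic heawood.
Proof.
have inl_inj : injective (@inl 'I_7 'I_7) by move=> ? ? [].
have inr_inj : injective (@inr 'I_7 'I_7) by move=> ? ? [].
case=> [p|l].
  rewrite -[RHS](fano_lines_through_point p) -(card_imset _ inr_inj).
  apply: eq_card => -[q|m]; rewrite inE.
    by apply/esym/negbTE/negP => /imsetP[].
  by rewrite mem_imset // inE.
rewrite -[RHS](fano_points_on_line l) -(card_imset _ inl_inj).
apply: eq_card => -[q|m]; rewrite inE; last first.
  by apply/esym/negbTE/negP => /imsetP[].
by rewrite mem_imset // inE.
Qed.

Lemma heawood_triangle_less : triangle_less heawood.
Proof. by case=> [a|a] [b|b] [c|c]. Qed.

(** A square would consist of two points on two distinct common lines. *)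
Lemma heawood_square_less : square_less heawood.
Proof.
have fano_sq (p q l m : 'I_7) : fano_incident p l -> fano_incident p m ->
    fano_incident q l -> fano_incident q m -> p != q -> l = m.
  move=> pl pm ql qm pq; have /eqP/cards1P[n lines_pq] := fano_line_through pq.
  have : l \in [set l | fano_incident p l && fano_incident q l] by rewrite inE pl ql.
  have : m \in [set l | fano_incident p l && fano_incident q l] by rewrite inE pm qm.
  by rewrite lines_pq !inE => /eqP-> /eqP->.
case=> [a|a] [b|b] [c|c] [d|d] //= ab bc cd da ac bd.
  by move: bd; rewrite (fano_sq _ _ _ _ ab da bc cd) ?eqxx.
by move: ac; rewrite (fano_sq _ _ _ _ ab bc da cd) ?eqxx.
Qed.

Lemma fano_common_line (p q : 'I_7) : exists2 l, fano_incident p l & fano_incident q l.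
Proof.
have [<-|pq] := eqVneq p q.
  have /card_gt0P[l] : (0 < #|[set l | fano_incident p l]|)%N.
    by rewrite fano_lines_through_point.
  by rewrite inE => pl; exists l.
have /card_gt0P[l] : (0 < #|[set l | fano_incident p l && fano_incident q l]|)%N.
  by rewrite fano_line_through.
by rewrite inE => /andP[]; exists l.
Qed.

Lemma fano_common_point (l m : 'I_7) : exists2 p, fano_incident p l & fano_incident p m.
Proof.
have [<-|lm] := eqVneq l m.
  have /card_gt0P[p] : (0 < #|[set p | fano_incident p l]|)%N.
    by rewrite fano_points_on_line.
  by rewrite inE => pl; exists p.
have /card_gt0P[p] : (0 < #|[set p | fano_incident p l && fano_incident p m]|)%N.
  by rewrite fano_lines_meet.
by rewrite inE => /andP[]; exists p.
Qed.

(** If [v] is a point, then [u'] and the end [x] of the walk are lines, and these meet; dually, two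
    points lie on a common line. *)
Lemma heawood_heawood_like : heawood_like heawood.
Proof.
apply/heawood_likeP => -[v|v] [u|u] [w|w] [x|x] [u'|u'] //= _ _ _ _.
  by have [p pu' px] := fano_common_point u' x; exists (inl p).
by have [l u'l xl] := fano_common_line u' x; exists (inr l).
Qed.

Lemma heawood_connected (a b : heawood) : connect (@adj heawood) a b.
Proof.
have PP (p q : 'I_7) : connect (@adj heawood) (inl p) (inl q).
  have [l pl ql] := fano_common_line p q.
  by apply: (@connect_trans _ _ (inr l)); apply: connect1.
have LP (l q : 'I_7) : connect (@adj heawood) (inr l) (inl q).
  have [p pl _] := fano_common_point l l.
  by apply: connect_trans (PP p q); apply: connect1.
have conn_sym := sym_connect_sym (@adj_sym heawood).
have LL (l m : 'I_7) : connect (@adj heawood) (inr l) (inr m).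
  have [p pl pm] := fano_common_point l m.
  by apply: (@connect_trans _ _ (inl p)); apply: connect1.
by case: a b => [p|l] [q|m]; rewrite // conn_sym.
Qed.

(** The walk and [u'] lie in the component of [v], so the property is transported along its
    isomorphism. *)
Lemma union_of_copies_heawood_like (G : sgraph) :
  union_of_copies heawood G -> heawood_like G.
Proof.
move=> copies; apply/heawood_likeP => v u w x u' vu uw wx vu'.
have [f [g fK gK] f_adj] := copies v.
have cv : connect (@adj G) v v := connect0 _ v.
have cu : connect (@adj G) v u := connect1 vu.
have cw : connect (@adj G) v w := connect_trans cu (connect1 uw).
have cx : connect (@adj G) v x := connect_trans cw (connect1 wx).
have cu' : connect (@adj G) v u' := connect1 vu'.
pose c y (cy : connect (@adj G) v y) : component v := exist _ y cy.
have /heawood_likeP HH := heawood_heawood_like.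
have [||||y u'y yx] := HH (f (c _ cv)) (f (c _ cu)) (f (c _ cw))
  (f (c _ cx)) (f (c _ cu')).
- by rewrite f_adj.
- by rewrite f_adj.
- by rewrite f_adj.
- by rewrite f_adj.
exists (val (g y)).
  by move: u'y; rewrite -{1}[y]gK f_adj.
by move: yx; rewrite -{1}[y]gK f_adj.
Qed.

(** * Recovering the Fano plane from the local property *)

Section Embedding.
Variables (G : sgraph).
Hypotheses (cubG : cubic G) (noC3 : triangle_less G) (noC4 : square_less G).

Definition fano_map (P L : seq G) (v : G) (h : heawood) : G :=
  match h with inl p => nth v P p | inr l => nth v L l end.

(* [P] lists the images of the points 0, ..., 6 of the Fano plane and [L] those of
   the lines; the lines through 0 are 0, 4 and 6. *)
Lemma fano_labelling v : heawood_like G ->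
  exists P L : seq G,
    [/\ size P = 7%N, size L = 7%N, uniq P & uniq L] /\
    (nth v P 0 = v /\
     forall p l : 'I_7, fano_incident p l -> adj (nth v P p) (nth v L l)).
Proof.
move=> /heawood_likeP HG.
have [u0 [u1 [u2 [w00 [w01 [_1 [_2 [_3 [_4 ballP]]]]]]]]] := some_ball cubG noC3 noC4 v.
have [[vu0 vu1 vu2] [u0w0 u0w1] _ _] := ball_adj ballP.
have [Nv N0 _ _ uniqB] := ballP; clear ballP.
have U := mask_uniq uniqB; pose t := true; pose f := false.
have : uniq [:: u0; u1; u2] := U [:: f; t; t; t].
rewrite /= !inE negb_or !andbT => /andP[/andP[u01 u02] u12].
have : uniq [:: v; w00; w01] := U [:: t; f; f; f; t; t].
rewrite /= !inE negb_or !andbT => /andP[/andP[vw00 vw01] w00_01].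
clear _1 _2 _3 _4 uniqB U.
have sym (a b : G) : adj a b -> adj b a by rewrite adj_sym.
have [x [y [Nw00 Uw00]]] := cubic_nbhd cubG (sym _ _ u0w0).
have [_ w00x w00y] := in_nbhd3 Nw00.
move: Uw00; rewrite /= !inE negb_or !andbT => /andP[/andP[u0x u0y] xy].
have [a [b [Nw01 Uw01]]] := cubic_nbhd cubG (sym _ _ u0w1).
have [_ w01a w01b] := in_nbhd3 Nw01.
move: Uw01; rewrite /= !inE negb_or !andbT => /andP[/andP[u0a u0b] ab].
have outer w z : adj u0 w -> v != w -> adj w z -> u0 != z -> ~~ adj v z.
  move=> u0w vw wz u0z; apply/negP => vz.
  exact: (noC4 vu0 u0w wz (sym _ _ vz) vw u0z).
have common u w z : adj v u -> adj u0 w -> v != w -> adj w z -> u0 != z ->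
    exists c, [/\ adj u c, adj z c & v != c].
  move=> vu u0w vw wz u0z; have [c uc cz] := HG v u0 w z u vu0 u0w wz vu.
  exists c; split=> //; first exact: sym.
  by apply: contraNneq (outer w z u0w vw wz u0z) => ->.
have C p q c d : adj v p -> adj v q -> p != q -> adj p c -> adj q d -> v != c ->
    c != d.
  move=> vp vq pq pc qd vc; apply/eqP => eq_cd; rewrite -eq_cd in qd.
  exact: (noC4 vp pc (sym _ _ qd) (sym _ _ vq) vc pq).
have sq (p q c d : G) : adj p c -> adj p d -> adj q c -> adj q d -> p != q -> c = d.
  move=> pc pd qc qd pq; apply/eqP/negPn/negP => cd.
  exact: (noC4 pc (sym _ _ qc) qd (sym _ _ pd) pq cd).
(* [x] and [y] each share a neighbour with [u1] and with [u2]. The distinctness proved next shows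
   that these are all the neighbours of [u1] and [u2] other than [v]. *)
have [w11 [u1w11 xw11 vw11]] := common u1 w00 x vu1 u0w0 vw00 w00x u0x.
have [w10 [u1w10 yw10 vw10]] := common u1 w00 y vu1 u0w0 vw00 w00y u0y.
have [w20 [u2w20 xw20 vw20]] := common u2 w00 x vu2 u0w0 vw00 w00x u0x.
have [w21 [u2w21 yw21 vw21]] := common u2 w00 y vu2 u0w0 vw00 w00y u0y.
have w00_w11 : w00 != w11 by apply: (C u0 u1).
have w00_w20 : w00 != w20 by apply: (C u0 u2).
have w10_11 : w11 != w10.
  apply: contraNneq w00_w11 => eq_w; apply/eqP.
  by apply: (sq x y) => //; rewrite ?eq_w //; exact: sym.
have w20_21 : w20 != w21.
  apply: contraNneq w00_w20 => eq_w; apply/eqP.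
  by apply: (sq x y) => //; rewrite ?eq_w //; exact: sym.
have nbr3 u p q c : adj v u -> adj u p -> adj u q -> v != p -> v != q -> p != q ->
    adj u c -> v != c -> c = p \/ c = q.
  move=> vu up uq vp vq pq uc vc.
  have [r [Nu _]] := cubic_nbhd2 cubG up uq pq.
  have : v \in nbhd u by rewrite inE adj_sym.
  have : c \in nbhd u by rewrite inE.
  rewrite Nu !inE (negbTE vp) (negbTE vq) /= => /orP[/orP[]/eqP-> _|/eqP eq_c eq_v].
  - by left.
  - by right.
  - by rewrite eq_c eq_v in vc.
have xz z : adj w01 z -> u0 != z -> x != z.
  move=> w01z u0z; apply: contraNneq u0z => eq_xz; apply/eqP.
  by rewrite eq_xz in w00x; apply: (sq w00 w01) => //; exact: sym.
have yz z : adj w01 z -> u0 != z -> y != z.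
  move=> w01z u0z; apply: contraNneq u0z => eq_yz; apply/eqP.
  by rewrite eq_yz in w00y; apply: (sq w00 w01) => //; exact: sym.
(* [a] and [b] reach different outer neighbours of [u1], or a square arises; [x'] names the one
   adjacent to [w11]. *)
have [x' [y' [w01x' w01y' [u0x' u0y' x'y'] [x'w11 y'w10]]]] : exists x' y',
    [/\ adj w01 x', adj w01 y', [/\ u0 != x', u0 != y' & x' != y']
      & adj x' w11 /\ adj y' w10].
  have [c [u1c ac vc]] := common u1 w01 a vu1 u0w1 vw01 w01a u0a.
  have [d [u1d bd vd]] := common u1 w01 b vu1 u0w1 vw01 w01b u0b.
  have cd : c != d.
    apply/eqP => eq_cd; have w01c : w01 != c by apply: (C u0 u1).
    case/eqP: w01c; rewrite -eq_cd in bd.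
    by apply: (sq a b) => //; exact: sym.
  have [eq_c|eq_c] := nbr3 u1 w11 w10 c vu1 u1w11 u1w10 vw11 vw10 w10_11 u1c vc;
  have [eq_d|eq_d] := nbr3 u1 w11 w10 d vu1 u1w11 u1w10 vw11 vw10 w10_11 u1d vd.
  - by rewrite eq_c eq_d eqxx in cd.
  - by exists a, b; rewrite -eq_c -eq_d.
  - by exists b, a; rewrite -eq_c -eq_d [b == a]eq_sym.
  - by rewrite eq_c eq_d eqxx in cd.
(* [x'] already shares [w11] with [x], so it cannot also share [w20], which leaves [w21]; likewise
   [y'] is left with [w20]. *)
have x'w21 : adj x' w21.
  have [c [u2c x'c vc]] := common u2 w01 x' vu2 u0w1 vw01 w01x' u0x'.
  have [eq_c|<- //] := nbr3 u2 w20 w21 c vu2 u2w20 u2w21 vw20 vw21 w20_21 u2c vc.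
  have : w11 != w20 by apply: (C u1 u2).
  by case/eqP; apply: (sq x x') => //; [rewrite -eq_c | exact: xz].
have y'w20 : adj y' w20.
  have [c [u2c y'c vc]] := common u2 w01 y' vu2 u0w1 vw01 w01y' u0y'.
  have [<- //|eq_c] := nbr3 u2 w20 w21 c vu2 u2w20 u2w21 vw20 vw21 w20_21 u2c vc.
  have : w10 != w21 by apply: (C u1 u2).
  by case/eqP; apply: (sq y y') => //; [rewrite -eq_c | exact: yz].
(* The neighbours of entry [l] of the second list stand at positions [l], [l+1], [l+3] modulo 7 of
   the first; for instance [u0] has [v], [w00], [w01] at 0, 1, 3. *)
exists [:: v; w00; w11; w01; w20; w21; w10], [:: u0; x; x'; y'; u2; y; u1].
split; [split=> //|split=> //].
- rewrite /= !inE !negb_or.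
  do ?[apply/andP; split] => //;
  by [apply: (C u0 u1) | apply: (C u0 u2) | apply: (C u1 u2)
    | rewrite eq_sym; apply: (C u0 u1) | rewrite eq_sym; apply: (C u0 u2)
    | rewrite eq_sym; apply: (C u1 u2)].
- have uz u w z : adj v u -> adj u0 w -> v != w -> adj w z -> u0 != z -> u != z.
    by move=> vu u0w vw wz u0z; apply: contraNneq (outer w z u0w vw wz u0z) => <-.
  rewrite /= !inE !negb_or.
  do ?[apply/andP; split] => //;
  by [apply: xz | rewrite eq_sym; apply: yz | apply: (uz _ w00) | apply: (uz _ w01)
    | rewrite eq_sym; apply: (uz _ w00) | rewrite eq_sym; apply: (uz _ w01)
    | rewrite eq_sym].
case=> [p p7] [l l7]; case: p p7 => [|[|[|[|[|[|[|p]]]]]]] p7 //;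
  case: l l7 => [|[|[|[|[|[|[|l]]]]]]] l7 //= _; by [|apply: sym].
Qed.

End Embedding.

(** By equality of degrees, [g] maps each neighbourhood onto a whole neighbourhood. Its image is
    thus closed under adjacency and, as [H] is connected, is exactly one component. *)
Lemma isomorphic_component (H G : sgraph) (g : H -> G) (h0 : H) :
    cubic H -> cubic G -> injective g -> (forall a b, adj a b -> adj (g a) (g b)) ->
    (forall a b, connect (@adj H) a b) ->
  isomorphic (component (g h0)) H.
Proof.
move=> cubH cubG g_inj g_hom connH.
have nbhd_g a : nbhd (g a) = g @: nbhd a.
  apply/esym/eqP; rewrite eqEcard card_imset //.
  rewrite [#|nbhd a|](cubH a) [#|nbhd _|](cubG (g a)) leqnn andbT.
  by apply/subsetP => y /imsetP[b]; rewrite !inE => ab ->; apply: g_hom.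
have g_adj a b : adj (g a) (g b) = adj a b.
  have -> : adj (g a) (g b) = (g b \in nbhd (g a)) by rewrite inE.
  by rewrite nbhd_g mem_imset // inE.
have codom_closed : closed (@adj G) (codom g).
  apply: intro_closed; first exact/sym_connect_sym/adj_sym.
  move=> y z yz /codomP[a eq_y]; rewrite eq_y in yz.
  have : z \in nbhd (g a) by rewrite inE.
  by rewrite nbhd_g => /imsetP[b _ ->]; apply: codom_f.
have codomP (y : component (g h0)) : val y \in codom g.
  by rewrite -(closed_connect codom_closed (valP y)) codom_f.
have conn_g a : connect (@adj G) (g h0) (g a).
  have g_connect p h : path (@adj H) h p -> connect (@adj G) (g h) (g (last h p)).
    elim: p h => [|b p IHp] h //= /andP[hb path_p].
    exact: connect_trans (connect1 (g_hom _ _ hb)) (IHp _ path_p).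
  by have /connectP[p path_p ->] := connH h0 a; apply: g_connect.
pose f (y : component (g h0)) := iinv (codomP y).
have gf y : g (f y) = val y by apply: f_iinv.
exists f; last by move=> y z; rewrite -g_adj !gf.
exists (fun a => exist _ (g a) (conn_g a)) => [y|a]; last by apply: g_inj; rewrite gf.
by apply: val_inj; rewrite /= gf.
Qed.

Lemma heawood_like_union_of_copies (G : sgraph) :
    cubic G -> triangle_less G -> square_less G ->
  heawood_like G -> union_of_copies heawood G.
Proof.
move=> cubG noC3 noC4 HG v.
have [P [L [[sizeP sizeL uniqP uniqL] [P0 PL_adj]]]] :=
  fano_labelling cubG noC3 noC4 v HG.
pose g := fano_map P L v.
have P_inj (p q : 'I_7) : nth v P p = nth v P q -> p = q.
  by move=> /eqP; rewrite nth_uniq ?sizeP // => /eqP /val_inj.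
have L_inj (l m : 'I_7) : nth v L l = nth v L m -> l = m.
  by move=> /eqP; rewrite nth_uniq ?sizeL // => /eqP /val_inj.
(* If a point [p] and a line [l] had the same image, a point [q] on [l] and a line [m] through [p]
   and [q] would complete a triangle. *)
have PL_neq (p l : 'I_7) : nth v P p <> nth v L l.
  move=> eq_pl; have [q ql _] := fano_common_point l l.
  have [m pm qm] := fano_common_line p q.
  have := PL_adj q l ql; rewrite -eq_pl => qp.
  by apply: (noC3 _ _ _ qp (PL_adj _ _ pm) (PL_adj _ _ qm)).
have g0 : g (inl ord0) = v by [].
rewrite -{1}g0; apply: isomorphic_component => //.
- exact: heawood_cubic.
- case=> [p|l] [q|m] /=; rewrite /g /fano_map.
  + by move/P_inj->.
  + by move/PL_neq.
  + by move/esym/PL_neq.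
  + by move/L_inj->.
- case=> [p|l] [q|m] //=; first exact: PL_adj.
  by move=> ?; rewrite adj_sym; apply: PL_adj.
- exact: heawood_connected.
Qed.

(** ** From the derivative to the logarithm *)

Lemma is_derive_ln_horner (R : realType) (P : {poly R}) (x : R) : 0 < P.[x] ->
  is_derive x (1 : R) (@ln R \o horner P) (P^`().[x] / P.[x]).
Proof.
move=> Px_gt0; rewrite mulrC; apply: is_derive1_comp.
exact: is_derive1_ln.
Qed.

Lemma ln_horner_mean_value (R : realType) (P Q : {poly R}) (a b l : R) :
    0 < l -> P.[0] = 1 -> Q.[0] = 1 ->
    (forall x : R, 0 <= x -> 0 < P.[x]) -> (forall x : R, 0 <= x -> 0 < Q.[x]) ->
  exists2 c, 0 < c & a * ln P.[l] - b * ln Q.[l] =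
    (a * (P^`().[c] / P.[c]) - b * (Q^`().[c] / Q.[c])) * l.
Proof.
move=> l_gt0 P0 Q0 P_gt0 Q_gt0.
pose f : R -> R := fun x => a * ln P.[x] - b * ln Q.[x].
pose df x := a * (P^`().[x] / P.[x]) - b * (Q^`().[x] / Q.[x]).
have f_drv (x : R) : 0 <= x -> is_derive x (1 : R) f (df x).
  move=> x_ge0; have dP := is_derive_ln_horner (P_gt0 x x_ge0).
  have dQ := is_derive_ln_horner (Q_gt0 x x_ge0).
  exact: is_deriveB (is_deriveZ a dP) (is_deriveZ b dQ).
have [|||c] := @MVT R f df 0 l.
- exact: l_gt0.
- by move=> x; rewrite in_itv /= => /andP[/ltW x_ge0 _]; apply: f_drv.
- apply: derivable_within_continuous => x; rewrite in_itv /= => /andP[x_ge0 _].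
  by have [] := f_drv x x_ge0.
rewrite in_itv /= => /andP[c_gt0 _] f_c; exists c => //.
have f0 : f 0 = 0 by rewrite /f P0 Q0 ln1 !mulr0 subrr.
by rewrite f0 !subr0 in f_c; rewrite -[RHS]f_c.
Qed.

(** * Independence polynomials and their logarithmic derivatives *)

Section IndepPolynomial.
Variables (R : realType).
Implicit Types (G : sgraph) (x : R).

Definition indep_polynomial G : {poly R} := \sum_(I in indep_sets G) 'X^#|I|.

Lemma horner_indep_polynomial G x : (indep_polynomial G).[x] = indep_poly G x.
Proof.
by rewrite /indep_polynomial horner_sum; apply: eq_bigr => I _; rewrite hornerXn.
Qed.

Lemma indep_poly_hweight G x : indep_poly G x = \sum_(I : {set G}) hweight x I.
Proof. by rewrite /indep_poly big_mkcond. Qed.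

Lemma horner_deriv_indep_polynomial G x :
  x * (indep_polynomial G)^`().[x] = \sum_(I : {set G}) hweight x I * #|I|%:R.
Proof.
rewrite /indep_polynomial linear_sum /= horner_sum mulr_sumr big_mkcond /=.
apply: eq_bigr => I _; rewrite /hweight; case: ifP => _; last by rewrite mul0r.
rewrite derivXn hornerMn hornerXn -[X in x * X]mulr_natr mulrA.
(* The empty set contributes zero; otherwise [x] restores the exponent lowered by
   differentiation. *)
by case: #|I| => [|n]; rewrite ?mulr0 //= -exprS.
Qed.

Lemma set0_indep G : set0 \in indep_sets G.
Proof. by apply/indepP => a b; rewrite inE. Qed.

Lemma indep_poly_gt0 G x : 0 <= x -> 0 < indep_poly G x.
Proof.
move=> x_ge0; rewrite /indep_poly (bigD1 set0) ?set0_indep //= cards0 expr0.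
by rewrite ltr_pwDl // sumr_ge0 // => I _; rewrite exprn_ge0.
Qed.

Lemma indep_poly0 G : indep_poly G (0 : R) = 1.
Proof.
rewrite /indep_poly (bigD1 set0) ?set0_indep //= cards0 expr0 big1 ?addr0 //.
by move=> I /andP[_ I_neq0]; rewrite expr0n cards_eq0 (negbTE I_neq0).
Qed.

Lemma indep_poly1 G : indep_poly G (1 : R) = #|indep_sets G|%:R.
Proof.
by rewrite /indep_poly (eq_bigr (fun=> 1)) ?sumr_const // => I _; rewrite expr1n.
Qed.

Lemma sum_hweight_gain G x : cubic G ->
  \sum_(v : G) \sum_(I : {set G}) hweight x I * gain x v I =
  3 * (#|G|%:R * zpeval x Fpoly * indep_poly G x
       - zpeval x Dpoly * (x * (indep_polynomial G)^`().[x])).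
Proof.
move=> cubG; rewrite exchange_big horner_deriv_indep_polynomial.
under eq_bigr => I _ do rewrite -mulr_sumr sum_gain // mulrBr.
rewrite sumrB indep_poly_hweight mulrBr !mulr_sumr; congr (_ - _);
  by apply: eq_bigr => I _; ring.
Qed.

(** Multiplied by [x], this is the expected density of the random independent set. *)
Definition log_derivative G x : R :=
  #|G|%:R^-1 * ((indep_polynomial G)^`().[x] / (indep_polynomial G).[x]).

(* This is the logarithmic derivative of the Heawood graph because the latter is
   [heawood_like]; no independence polynomial is ever computed. *)
Definition heawood_log_derivative x : R :=
  zpeval x Fpoly / (x * zpeval x Dpoly).

Section Bound.
Variable G : sgraph.
Hypotheses (G_gt0 : (0 < #|G|)%N) (cubG : cubic G).
Hypotheses (noC3 : triangle_less G) (noC4 : square_less G).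
Variable x : R.
Hypothesis x_gt0 : 0 < x.

(** The gap is the total expected gain up to a positive factor, so the two have the same sign. *)
Lemma log_derivative_gap :
  heawood_log_derivative x - log_derivative G x =
  (\sum_(v : G) \sum_(I : {set G}) hweight x I * gain x v I) *
  (3 * #|G|%:R * x * zpeval x Dpoly * indep_poly G x)^-1.
Proof.
have D_gt0 : 0 < zpeval x Dpoly by apply: zpeval_gt0.
have P_gt0 := indep_poly_gt0 G (ltW x_gt0).
have n_gt0 : 0 < #|G|%:R :> R by rewrite ltr0n.
rewrite sum_hweight_gain // /log_derivative /heawood_log_derivative.
rewrite horner_indep_polynomial; move: (_^`().[x]) => dP.
move: (zpeval x Dpoly) (zpeval x Fpoly) (indep_poly G x) (#|G|%:R) D_gt0 P_gt0 n_gt0.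
move=> D F P n D_gt0 P_gt0 n_gt0.
by field; rewrite !gt_eqF.
Qed.

Lemma gap_denominator_gt0 :
  0 < (3 * #|G|%:R * x * zpeval x Dpoly * indep_poly G x)^-1.
Proof.
rewrite invr_gt0 !mulr_gt0 ?ltr0n ?indep_poly_gt0 //; last exact: ltW.
exact: zpeval_gt0.
Qed.

Lemma log_derivative_le : log_derivative G x <= heawood_log_derivative x.
Proof.
rewrite -subr_ge0 log_derivative_gap mulr_ge0 ?(ltW gap_denominator_gt0) //.
by apply: sumr_ge0 => v _; apply: sum_gain_ge0.
Qed.

Lemma log_derivative_lt : ~~ heawood_like G ->
  log_derivative G x < heawood_log_derivative x.
Proof.
move=> /(not_heawood_like_gain_gt0 cubG noC3 noC4 x_gt0)[v v_gt0].
rewrite -subr_gt0 log_derivative_gap mulr_gt0 ?gap_denominator_gt0 //.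
rewrite (bigD1 v) //= ltr_pwDl //.
by apply: sumr_ge0 => w _; apply: sum_gain_ge0.
Qed.

Lemma log_derivative_eq : heawood_like G ->
  log_derivative G x = heawood_log_derivative x.
Proof.
move=> HG; apply/esym/eqP; rewrite -subr_eq0 log_derivative_gap big1 ?mul0r //.
by move=> v _; apply: heawood_like_sum_gain.
Qed.

End Bound.

End IndepPolynomial.

Theorem corollary6 (R : realType) (G : sgraph)
    (G_nonempty : (0 < #|G|)%N) (G_cubic : cubic G)
    (G_girth : girth_at_least 5 G) :
  (forall lambda : R, 0 < lambda ->
     #|G|%:R^-1 * ln (indep_poly G lambda)
       <= 14%:R^-1 * ln (indep_poly heawood lambda)
     /\ (#|G|%:R^-1 * ln (indep_poly G lambda)
           = 14%:R^-1 * ln (indep_poly heawood lambda)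
         <-> union_of_copies heawood G))
  /\ (#|G|%:R^-1 * ln (#|indep_sets G|%:R : R)
        <= 14%:R^-1 * ln #|indep_sets heawood|%:R
      /\ (#|G|%:R^-1 * ln (#|indep_sets G|%:R : R)
            = 14%:R^-1 * ln #|indep_sets heawood|%:R
          <-> union_of_copies heawood G)).
Proof.
have noC3 := girth5_triangle_less G_girth.
have noC4 := girth5_square_less G_girth.
have card_heawood : #|heawood| = 14%N by rewrite card_sum !card_ord.
have heawood_gt0 : (0 < #|heawood|)%N by rewrite card_heawood.
have heawood_drv x : 0 < x ->
    log_derivative heawood x = heawood_log_derivative x :> R.
  move=> x_gt0; apply: log_derivative_eq => //; [exact: heawood_cubic
    | exact: heawood_triangle_less | exact: heawood_square_less
    | exact: heawood_heawood_like].
have main (l : R) : 0 < l ->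
    #|G|%:R^-1 * ln (indep_poly G l) <= 14%:R^-1 * ln (indep_poly heawood l)
    /\ (#|G|%:R^-1 * ln (indep_poly G l) = 14%:R^-1 * ln (indep_poly heawood l)
         <-> union_of_copies heawood G).
  move=> l_gt0.
  have [|||| c c_gt0] := @ln_horner_mean_value R (indep_polynomial R G)
    (indep_polynomial R heawood) #|G|%:R^-1 14%:R^-1 l l_gt0.
  - by rewrite horner_indep_polynomial indep_poly0.
  - by rewrite horner_indep_polynomial indep_poly0.
  - by move=> x x_ge0; rewrite horner_indep_polynomial indep_poly_gt0.
  - by move=> x x_ge0; rewrite horner_indep_polynomial indep_poly_gt0.
  rewrite ![(indep_polynomial _ _).[l]]horner_indep_polynomial -{2}card_heawood.
  rewrite -!/(log_derivative _ c) heawood_drv // => gap; split.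
    rewrite -subr_le0 gap pmulr_lle0 // subr_le0.
    exact: log_derivative_le.
  split=> [/eqP|/union_of_copies_heawood_like HG]; last first.
    by apply/eqP; rewrite -subr_eq0 gap log_derivative_eq // subrr mul0r.
  (* Equality at [l] forces equal logarithmic derivatives at the intermediate point [c > 0], where
     they differ strictly unless [G] is [heawood_like]. *)
  rewrite -subr_eq0 gap mulf_eq0 (gt_eqF l_gt0) orbF subr_eq0 => /eqP eq_drv.
  apply: heawood_like_union_of_copies => //.
  apply/negPn/negP => /(log_derivative_lt G_nonempty G_cubic noC3 noC4 c_gt0).
  by rewrite eq_drv ltxx.
split=> //.
by have := main 1 ltr01; rewrite !indep_poly1.
Qed.
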